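(* (Subject reduction for synchronous processes.) If $\Gamma\vdash_s P\triangleright\Delta$ and $P\to_s^* Q$, then $\Gamma\vdash_s Q\triangleright\Delta$.
   Context: Synchronous session calculus. There are countable sets of channel variables $x,y,z,\ldots$, linear channels $a,b,c,d,\ldots$, labels $l,l_i,\ldots$ and process variables $X,Y,\ldots$; identifiers are $u ::= a \mid x$. Processes are $P ::= \mathbf 0 \mid X\langle\tilde u\rangle \mid \sum_{i\in I} u?l_i(x_i).P_i \mid u!l\langle u'\rangle.P \mid P\,|\,P \mid P\oplus P \mid \mathbf{def}\ X(\tilde x)=P\ \mathbf{in}\ P \mid (\nu ab)P \mid \mathtt{error}$, where in an input the labels $l_i$ are pairwise distinct, and recursion is guarded. Binders: $x_i$ in inputs, $\tilde x$ and $X$ in definitions, and $a,b$ in $(\nu ab)P$ (co-channels); processes are considered up to $\alpha$-conversion. $\mathrm{fc}(P)$ is the set of free linear channels of $P$; free subject channels: $\mathrm{sc}(u!l\langle u'\rangle.P)=\mathrm{fc}(u)\cup\mathrm{sc}(P)$, $\mathrm{sc}(\sum_i u?l_i(x_i).P_i)=\mathrm{fc}(u)\cup\bigcup_i\mathrm{sc}(P_i)$, $\mathrm{sc}(\mathbf{def}\ D\ \mathbf{in}\ P)=\mathrm{sc}(P)$, with $\mathrm{fc}(x)=\emptyset$, $\mathrm{fc}(a)=\{a\}$, and $\mathrm{sc}$ defined structurally on the other constructors (union over components of $|$ and $\oplus$, removing $a,b$ under $(\nu ab)$, empty for $\mathbf 0$, calls and $\mathtt{error}$). Structural congruence $\equiv$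 is the least congruence with: $\mathbf 0|P\equiv P$; $|$ and $\oplus$ commutative and associative; $(\nu ab)\mathbf 0\equiv\mathbf 0$; $((\nu ab)P)|Q\equiv(\nu ab)(P|Q)$; $(\nu ab)(\nu cd)P\equiv(\nu cd)(\nu ab)P$; $\mathbf{def}\ D\ \mathbf{in}\ \mathbf 0\equiv\mathbf 0$; $\mathbf{def}\ D\ \mathbf{in}\ (\nu ab)P\equiv(\nu ab)(\mathbf{def}\ D\ \mathbf{in}\ P)$; $(\mathbf{def}\ D\ \mathbf{in}\ P)|Q\equiv\mathbf{def}\ D\ \mathbf{in}\ (P|Q)$; $\mathbf{def}\ D\ \mathbf{in}\ \mathbf{def}\ D'\ \mathbf{in}\ P\equiv\mathbf{def}\ D'\ \mathbf{in}\ \mathbf{def}\ D\ \mathbf{in}\ P$. Evaluation contexts: $C ::= [\,] \mid C|P \mid (\nu ab)C \mid \mathbf{def}\ D\ \mathbf{in}\ C$. The reduction $\to_s$ is the least relation closed under: $(\nu ab)(a!l_k\langle c\rangle.P \mid \sum_{i\in I} b?l_i(x_i).Q_i)\to(\nu ab)(P\mid Q_k\{c/x_k\})$ if $k\in I$; $\mathbf{def}\ X(\tilde x)=P\ \mathbf{in}\ (X\langle\tilde a\rangle\mid Q)\to\mathbf{def}\ X(\tilde x)=P\ \mathbf{in}\ (P\{\tilde a/\tilde x\}\mid Q)$; $P\oplus Q\to P$; $P\to P'$ implies $C[P]\to C[P']$; $P\equiv P'\to Q'\equiv Q$ implies $P\to Q$; error rules: $(\nu ab)(a!l\langle c\rangle.P\mid\sum_{i\in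 I}b?l_i(x_i).Q_i)\to\mathtt{error}$ if $l\neq l_i$ for all $i$; $(\nu ab)P\to\mathtt{error}$ if $a\in\mathrm{sc}(P)$, $b\notin\mathrm{fc}(P)$; $(\nu ab)(a!l\langle c\rangle.P\mid b!l'\langle c'\rangle.Q)\to\mathtt{error}$; $(\nu ab)(\sum_{i\in I}a?l_i(x_i).P_i\mid\sum_{j\in J}b?l'_j(x'_j).Q_j)\to\mathtt{error}$; $C[\mathtt{error}]\to\mathtt{error}$. $\to_s^*$ is its reflexive-transitive closure. Session types: $T,S ::= \&_{i\in I}?l_i(S_i).T_i \mid \bigoplus_{i\in I}!l_i\langle S_i\rangle.T_i \mid \mathbf t \mid \mu\mathbf t.T \mid \mathsf{end}$, pairwise distinct labels, closed exchanged types, contractive recursion, equi-recursive. Duality $\overline T$ swaps branchings and selections along continuations, keeping exchanged types, with $\overline{\mathbf t}=\mathbf t$, $\overline{\mu\mathbf t.T}=\mu\mathbf t.\overline T$, $\overline{\mathsf{end}}=\mathsf{end}$. Synchronous subtyping $\le_s$ is the largest relation on closed types such that $T\le_s S$ implies one of: $T=S=\mathsf{end}$; $T=\&_{i\in I\cup J}?l_i(S_i).T_i$, $S=\&_{i\in I}?l_i(S'_i).T'_i$, $S_i\le_s S'_i$, $T_i\le_s T'_i$ ($i\in I$); $T=\bigoplus_{i\in I}!l_i\langle S_i\rangle.T_i$, $S=\bigoplus_{i\in I\cup J}!l_i\langle S'_i\rangle.T'_i$, $S'_i\le_s S_i$, $T_i\le_s T'_i$ ($i\in I$). Typing: $\Gamma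 ::= \emptyset\mid\Gamma,X:\tilde T$; $\Delta ::= \emptyset\mid\Delta,u:T$; $\Delta_1\le_s\Delta_2$ means $\Delta_1(u)\le_s\Delta_2(u)$ on common domain and $\mathsf{end}$ elsewhere. $\Gamma\vdash_s P\triangleright\Delta$ is derived by: subsumption along $\le_s$ on environments; $\Gamma\vdash_s\mathbf 0\triangleright\emptyset$; $\Gamma,X:\tilde T\vdash_s X\langle\tilde u\rangle\triangleright\{\tilde u:\tilde T\}$; if $\Gamma\vdash_s P_i\triangleright\Delta,u:T_i,x_i:S_i$ ($i\in I$) then $\Gamma\vdash_s\sum_{i\in I}u?l_i(x_i).P_i\triangleright\Delta,u:\&_{i\in I}?l_i(S_i).T_i$; if $\Gamma\vdash_s P\triangleright\Delta,u:T$ then $\Gamma\vdash_s u!l\langle u'\rangle.P\triangleright\Delta,u:!l\langle S\rangle.T,u':S$; parallel composition splits the session environment into disjoint parts; choice uses the same environment for both branches; if $\Gamma,X:\tilde T\vdash_s P\triangleright\{\tilde x:\tilde T\}$ and $\Gamma,X:\tilde T\vdash_s Q\triangleright\Delta$ then $\Gamma\vdash_s\mathbf{def}\ X(\tilde x)=P\ \mathbf{in}\ Q\triangleright\Delta$; if $\Gamma\vdash_s P\triangleright\Delta,a:T,b:\overline T$ then $\Gamma\vdash_s(\nu ab)P\triangleright\Delta$. No rule types $\mathtt{error}$.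
   Formalization: Repairs to a claim that fails literally: def D in 0 ≡ 0 is used only from left to right; subsumption may drop an end-typed entry only if its identifier is not free in the process; input sums are non-empty. *)

(* Defs.v *)
From HB Require Import structures.
From mathcomp Require Import all_boot.
From Stdlib Require Import Relation_Operators.

Set Implicit Arguments.
Unset Strict Implicit.
Unset Printing Implicit Defensive.

(* Synchronous binary sessions.  Terms are in de Bruijn form, so that
   alpha-convertible terms are syntactically equal.  There are three
   independent index spaces: linear channels (nu binds two of them, 0 for the
   first co-channel and 1 for the second), channel variables (an input branch
   binds variable 0, a definition with n parameters binds variables 0 .. n-1
   in its body only) and process variables (a definition binds process
   variable 0 in its body and in its scope).  An index beyond the enclosing
   binders denotes a free name. *)

Definition label := nat.

(* A family indexed by labels, such as (l_i, P_i)_{i in I} with pairwise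
   distinct l_i, is an association list. *)
Fixpoint assoc (A : Type) (l : label) (s : seq (label * A)) : option A :=
  if s is (l', x) :: s' then if l == l' then Some x else assoc l s' else None.

Inductive stype : Type :=
| TEnd
| TVar of nat
| TMu of stype
| TIn of seq (label * (stype * stype))   (* &?l_i(S_i).T_i as (l_i, (S_i, T_i)) *)
| TOut of seq (label * (stype * stype)). (* (+)!l_i<S_i>.T_i likewise *)

(* U is only ever a closed type, hence it is not shifted under TMu. *)
Fixpoint tsubst (k : nat) (U T : stype) : stype :=
  match T with
  | TEnd => TEnd
  | TVar n => if n == k then U else if k < n then TVar n.-1 else TVar n
  | TMu T => TMu (tsubst k.+1 U T)
  | TIn bs =>
      TIn [seq (b.1, (tsubst k U b.2.1, tsubst k U b.2.2)) | b <- bs]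
  | TOut bs =>
      TOut [seq (b.1, (tsubst k U b.2.1, tsubst k U b.2.2)) | b <- bs]
  end.

Fixpoint dual (T : stype) : stype :=
  match T with
  | TEnd => TEnd
  | TVar n => TVar n
  | TMu T => TMu (dual T)
  | TIn bs => TOut [seq (b.1, (b.2.1, dual b.2.2)) | b <- bs]
  | TOut bs => TIn [seq (b.1, (b.2.1, dual b.2.2)) | b <- bs]
  end.

(* Type variable k does not occur at the head, below leading mu's only. *)
Fixpoint tguard (k : nat) (T : stype) : bool :=
  match T with
  | TVar n => n != k
  | TMu T => tguard k.+1 T
  | _ => true
  end.

(* Free type variables < k, contractive recursion, pairwise distinct labels,
   closed exchanged types. *)
Fixpoint wf_type_at (k : nat) (T : stype) : bool :=
  match T with
  | TEnd => true
  | TVar n => n < k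
  | TMu T => tguard 0 T && wf_type_at k.+1 T
  | TIn bs =>
      uniq (unzip1 bs) &&
      all (fun b => wf_type_at 0 b.2.1 && wf_type_at k b.2.2) bs
  | TOut bs =>
      uniq (unzip1 bs) &&
      all (fun b => wf_type_at 0 b.2.1 && wf_type_at k b.2.2) bs
  end.

Definition wf_type (T : stype) : bool := wf_type_at 0 T.

(* [unfolds T U]: unrolling the leading mu's of T yields U, which is not a
   recursive type.  Types being equi-recursive, "T = end", "T = &..." and
   "T = (+)..." are read as [unfolds T _]. *)
Inductive unfolds : stype -> stype -> Prop :=
| unfolds_end : unfolds TEnd TEnd
| unfolds_in bs : unfolds (TIn bs) (TIn bs)
| unfolds_out bs : unfolds (TOut bs) (TOut bs)
| unfolds_mu T U : unfolds (tsubst 0 (TMu T) T) U -> unfolds (TMu T) U.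

Inductive subtype_rules (R : stype -> stype -> Prop) : stype -> stype -> Prop :=
| sub_end T T' :
    unfolds T TEnd -> unfolds T' TEnd -> subtype_rules R T T'
| sub_in T T' bs bs' :
    unfolds T (TIn bs) -> unfolds T' (TIn bs') ->
    (forall l S1' T1', assoc l bs' = Some (S1', T1') ->
       exists S1 T1, assoc l bs = Some (S1, T1) /\ R S1 S1' /\ R T1 T1') ->
    subtype_rules R T T'
| sub_out T T' bs bs' :
    unfolds T (TOut bs) -> unfolds T' (TOut bs') ->
    (forall l S1 T1, assoc l bs = Some (S1, T1) ->
       exists S1' T1', assoc l bs' = Some (S1', T1') /\ R S1' S1 /\ R T1 T1') ->
    subtype_rules R T T'.

(* The largest relation on (well-formed) closed types satisfying the rules. *)
Definition subtype (T T' : stype) : Prop :=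
  exists R : stype -> stype -> Prop,
    (forall U U', R U U' -> wf_type U /\ wf_type U' /\ subtype_rules R U U') /\
    R T T'.

Inductive ident : Type := chan of nat | var of nat.

Definition ident_code (u : ident) : nat + nat :=
  match u with chan a => inl a | var x => inr x end.
Definition ident_decode (c : nat + nat) : ident :=
  match c with inl a => chan a | inr x => var x end.
Lemma ident_codeK : cancel ident_code ident_decode.
Proof. by case. Qed.
HB.instance Definition _ := Equality.copy ident (can_type ident_codeK).

Inductive proc : Type :=
| PNil
| PCall of nat & seq ident              (* X<u1, .., un> *)
| PInp of ident & seq (label * proc)    (* sum of the u?l_i(x_i).P_i *)
| POut of ident & label & ident & proc  (* u!l<u'>.P *)
| PPar of proc & proc
| PChoice of proc & proc
| PDef of nat & proc & proc             (* PDef n D P: def X(x1, .., xn) = D in P *)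
| PNu of proc
| PErr.

Definition shift_var (n : nat) (u : ident) : ident :=
  match u with chan a => chan a | var x => var (n + x) end.
Definition shift_chan (u : ident) : ident :=
  match u with chan a => chan a.+2 | var x => var x end.

Definition up_var (n : nat) (f : ident -> ident) (u : ident) : ident :=
  match u with
  | chan a => shift_var n (f (chan a))
  | var x => if x < n then var x else shift_var n (f (var (x - n)))
  end.
Definition up_chan (f : ident -> ident) (u : ident) : ident :=
  match u with
  | chan a => if a < 2 then chan a else shift_chan (f (chan (a - 2)))
  | var x => shift_chan (f (var x))
  end.
Definition up_pvar (g : nat -> nat) (k : nat) : nat :=
  if k is k'.+1 then (g k').+1 else 0.

(* Capture-avoiding simultaneous substitution of the identifiers by f and of
   the process variables by g. *)
Fixpoint psubst (f : ident -> ident) (g : nat -> nat) (P : proc) : proc :=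
  match P with
  | PNil => PNil
  | PCall X us => PCall (g X) (map f us)
  | PInp u bs => PInp (f u) [seq (b.1, psubst (up_var 1 f) g b.2) | b <- bs]
  | POut u l u' P => POut (f u) l (f u') (psubst f g P)
  | PPar P Q => PPar (psubst f g P) (psubst f g Q)
  | PChoice P Q => PChoice (psubst f g P) (psubst f g Q)
  | PDef n D P => PDef n (psubst (up_var n f) (up_pvar g) D) (psubst f (up_pvar g) P)
  | PNu P => PNu (psubst (up_chan f) g P)
  | PErr => PErr
  end.

(* P{c1/x1, .., cn/xn} where x1, .., xn are variables 0 .. n-1. *)
Definition inst (cs : seq nat) (P : proc) : proc :=
  psubst (fun u => match u with
                   | chan a => chan a
                   | var x => if x < size cs then chan (nth 0 cs x)
                              else var (x - size cs)
                   end) id P.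

Fixpoint free (u : ident) (P : proc) : bool :=
  match P with
  | PNil => false
  | PCall _ us => u \in us
  | PInp v bs => (u == v) || has (fun b => free (shift_var 1 u) b.2) bs
  | POut v _ v' P => [|| u == v, u == v' | free u P]
  | PPar P Q => free u P || free u Q
  | PChoice P Q => free u P || free u Q
  | PDef n D P => free (shift_var n u) D || free u P
  | PNu P => free (shift_chan u) P
  | PErr => false
  end.

(* a \in sc(P) *)
Fixpoint subject (a : nat) (P : proc) : bool :=
  match P with
  | PNil => false
  | PCall _ _ => false
  | PInp v bs => (chan a == v) || has (fun b => subject a b.2) bs
  | POut v _ _ P => (chan a == v) || subject a P
  | PPar P Q => subject a P || subject a Q
  | PChoice P Q => subject a P || subject a Q
  | PDef _ _ P => subject a P
  | PNu P => subject a.+2 P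
  | PErr => false
  end.

(* Process variable k occurs under input and output prefixes only. *)
Fixpoint pguard (k : nat) (P : proc) : bool :=
  match P with
  | PNil => true
  | PCall X _ => X != k
  | PInp _ _ => true
  | POut _ _ _ _ => true
  | PPar P Q => pguard k P && pguard k Q
  | PChoice P Q => pguard k P && pguard k Q
  | PDef _ D P => pguard k.+1 D && pguard k.+1 P
  | PNu P => pguard k P
  | PErr => true
  end.

(* Inputs have at least one branch: an input without branches could be typed
   in an environment with arbitrary unused non-end entries, and
   (nu ab)P --> error, for a \in sc(P) and b \notin fc(P), would then apply to
   typable processes. *)
Fixpoint wf_proc (P : proc) : bool :=
  match P with
  | PNil => true
  | PCall _ _ => true
  | PInp _ bs =>
      [&& 0 < size bs, uniq (unzip1 bs) & all (fun b => wf_proc b.2) bs]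
  | POut _ _ _ P => wf_proc P
  | PPar P Q => wf_proc P && wf_proc Q
  | PChoice P Q => wf_proc P && wf_proc Q
  | PDef _ D P => [&& pguard 0 D, wf_proc D & wf_proc P]
  | PNu P => wf_proc P
  | PErr => true
  end.

(* (nu cd) and (nu ab) exchanged *)
Definition swap_nu (u : ident) : ident :=
  match u with
  | chan 0 => chan 2 | chan 1 => chan 3 | chan 2 => chan 0 | chan 3 => chan 1
  | _ => u
  end.

Definition swap_pvar (k : nat) : nat :=
  match k with 0 => 1 | 1 => 0 | _ => k end.

(* The freshness side conditions of the named presentation appear as shifts. *)
Inductive scong_ax : proc -> proc -> Prop :=
| sc_par_nil P : scong_ax (PPar PNil P) P
| sc_par_comm P Q : scong_ax (PPar P Q) (PPar Q P)
| sc_par_assoc P Q R : scong_ax (PPar (PPar P Q) R) (PPar P (PPar Q R))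
| sc_choice_comm P Q : scong_ax (PChoice P Q) (PChoice Q P)
| sc_choice_assoc P Q R :
    scong_ax (PChoice (PChoice P Q) R) (PChoice P (PChoice Q R))
| sc_nu_nil : scong_ax (PNu PNil) PNil
| sc_nu_par P Q : scong_ax (PPar (PNu P) Q) (PNu (PPar P (psubst shift_chan id Q)))
| sc_nu_nu P : scong_ax (PNu (PNu P)) (PNu (PNu (psubst swap_nu id P)))
| sc_def_nu n D P :
    scong_ax (PDef n D (PNu P)) (PNu (PDef n (psubst shift_chan id D) P))
| sc_def_par n D P Q :
    scong_ax (PPar (PDef n D P) Q) (PDef n D (PPar P (psubst id S Q)))
| sc_def_def n D m D' P :
    scong_ax (PDef n D (PDef m (psubst id (up_pvar S) D') P))
             (PDef m D' (PDef n (psubst id (up_pvar S) D) (psubst id swap_pvar P))).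

(* All axioms hold in both directions, except for the garbage collection of
   definitions [def D in 0 == 0], which is used from left to right only: read
   from right to left it introduces an arbitrary D, e.g.
   0 (+) 0 --> 0 == def X() = error in 0, and no typing is preserved. *)
Inductive scong : proc -> proc -> Prop :=
| sc_refl P : scong P P
| sc_trans P Q R : scong P Q -> scong Q R -> scong P R
| sc_axiom P Q : scong_ax P Q -> scong P Q
| sc_axiom_sym P Q : scong_ax P Q -> scong Q P
| sc_def_nil n D : scong (PDef n D PNil) PNil
| sc_inp u bs1 l P P' bs2 :
    scong P P' ->
    scong (PInp u (bs1 ++ (l, P) :: bs2)) (PInp u (bs1 ++ (l, P') :: bs2))
| sc_out u l u' P P' : scong P P' -> scong (POut u l u' P) (POut u l u' P')
| sc_par P P' Q Q' : scong P P' -> scong Q Q' -> scong (PPar P Q) (PPar P' Q')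
| sc_choice P P' Q Q' :
    scong P P' -> scong Q Q' -> scong (PChoice P Q) (PChoice P' Q')
| sc_def n D D' P P' :
    scong D D' -> scong P P' -> scong (PDef n D P) (PDef n D' P')
| sc_nu P P' : scong P P' -> scong (PNu P) (PNu P').

Inductive ectx : Type :=
| EHole
| EPar of ectx & proc
| ENu of ectx
| EDef of nat & proc & ectx.

Fixpoint fill (C : ectx) (P : proc) : proc :=
  match C with
  | EHole => P
  | EPar C Q => PPar (fill C P) Q
  | ENu C => PNu (fill C P)
  | EDef n D C => PDef n D (fill C P)
  end.

Inductive red : proc -> proc -> Prop :=
| red_com l c P bs Q :
    assoc l bs = Some Q ->
    red (PNu (PPar (POut (chan 0) l (chan c) P) (PInp (chan 1) bs)))
        (PNu (PPar P (inst [:: c] Q)))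
| red_call n D cs Q :
    size cs = n ->
    red (PDef n D (PPar (PCall 0 (map chan cs)) Q)) (PDef n D (PPar (inst cs D) Q))
| red_choice P Q : red (PChoice P Q) P
| red_ctx C P P' : red P P' -> red (fill C P) (fill C P')
| red_struct P P' Q' Q : scong P P' -> red P' Q' -> scong Q' Q -> red P Q
| red_err_label l c P bs :
    assoc l bs = None ->
    red (PNu (PPar (POut (chan 0) l (chan c) P) (PInp (chan 1) bs))) PErr
| red_err_orphan P : subject 0 P -> ~~ free (chan 1) P -> red (PNu P) PErr
| red_err_out l c P l' c' Q :
    red (PNu (PPar (POut (chan 0) l (chan c) P) (POut (chan 1) l' (chan c') Q))) PErr
| red_err_inp bs bs' :
    red (PNu (PPar (PInp (chan 0) bs) (PInp (chan 1) bs'))) PErr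
| red_err_ctx C : red (fill C PErr) PErr.

Definition reds : proc -> proc -> Prop := clos_refl_trans proc red.

(* Position X holds the parameter types of process variable X, if any. *)
Definition penv := seq (option (seq stype)).

Definition senv := ident -> option stype.

Definition senv_finite (E : senv) : Prop :=
  exists n, forall k, n <= k -> E (chan k) = None /\ E (var k) = None.

Definition senv_empty : senv := fun _ => None.

(* E, u : T   (used with E u = None) *)
Definition senv_add (E : senv) (u : ident) (T : stype) : senv :=
  fun v => if v == u then Some T else E v.

(* {u1 : T1, .., un : Tn} *)
Definition senv_seq (us : seq ident) (Ts : seq stype) : senv :=
  fun v => nth None (map Some Ts) (index v us).

(* E, x : T   where x is bound as variable 0 *)
Definition senv_bind_var (T : stype) (E : senv) : senv :=
  fun v => match v with
           | var 0 => Some T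
           | var x.+1 => E (var x)
           | chan a => E (chan a)
           end.

(* E, a : T, b : T'   where a, b are bound as channels 0, 1 *)
Definition senv_bind_chan (T T' : stype) (E : senv) : senv :=
  fun v => match v with
           | chan 0 => Some T
           | chan 1 => Some T'
           | chan a.+2 => E (chan a)
           | var x => E (var x)
           end.

(* E is the union of E1 and E2, which have disjoint domains. *)
Definition senv_split (E E1 E2 : senv) : Prop :=
  forall u, (E1 u = E u /\ E2 u = None) \/ (E1 u = None /\ E2 u = E u).

Definition senv_sub (E E' : senv) : Prop :=
  forall u, match E u, E' u with
            | Some T, Some T' => subtype T T'
            | Some T, None => unfolds T TEnd
            | None, Some T' => unfolds T' TEnd
            | None, None => True
            end.

(* In a judgement the session environment covers the free identifiers of the
   process.  This is explicit in the subsumption rule, the only one that could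
   break it: there an end-typed entry is dropped only if its identifier is not
   free in the process.  If it could be free, an identifier c with a dropped
   entry might be received again at another type: the continuation of
   b?l(x).d!m<c>.x!n<e>.0 would be typable with d, e and x but without c, its
   instance d!m<c>.c!n<e>.0 would not be typable. *)
Inductive typing : penv -> proc -> senv -> Prop :=
| T_sub G P E E' :
    typing G P E -> senv_sub E E' -> senv_finite E' ->
    (forall u, free u P -> E' u <> None) ->
    typing G P E'
| T_nil G : typing G PNil senv_empty
| T_call G X us Ts :
    nth None G X = Some Ts -> all wf_type Ts ->
    size us = size Ts -> uniq us ->
    typing G (PCall X us) (senv_seq us Ts)
| T_inp G u bs E ts :
    E u = None -> unzip1 bs = unzip1 ts ->
    (forall l P S T, assoc l bs = Some P -> assoc l ts = Some (S, T) ->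
       typing G P (senv_bind_var S (senv_add E u T))) ->
    typing G (PInp u bs) (senv_add E u (TIn ts))
| T_out G u l u' P E S T :
    E u = None -> E u' = None -> u != u' -> wf_type S ->
    typing G P (senv_add E u T) ->
    typing G (POut u l u' P)
      (senv_add (senv_add E u (TOut [:: (l, (S, T))])) u' S)
| T_par G P Q E E1 E2 :
    senv_split E E1 E2 -> typing G P E1 -> typing G Q E2 ->
    typing G (PPar P Q) E
| T_choice G P Q E :
    typing G P E -> typing G Q E -> typing G (PChoice P Q) E
| T_def G n D P Ts E :
    size Ts = n ->
    typing (Some Ts :: G) D (senv_seq (map var (iota 0 n)) Ts) ->
    typing (Some Ts :: G) P E ->
    typing G (PDef n D P) E
| T_nu G P T E :
    typing G P (senv_bind_chan T (dual T) E) -> typing G (PNu P) E.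

(* Main.v *)
Require Import Defs.
From mathcomp Require Import all_boot.
From Stdlib Require List.

(* Subsumption can be pushed towards the leaves of a derivation, which makes
   typing invertible by the shape of the process ([typing_invP]).  The induction
   runs on the invariant [typing_regular]: the environment is finite, covers the
   free identifiers, and has only end-typed entries besides them; non-empty
   inputs are needed for it.  Hence the entries at non-free identifiers never
   matter, and typing is stable under every renaming that is injective on the
   free identifiers ([typing_psubst]).  This single lemma yields the
   substitution lemmas for both reductions and, through left inverses of shifts,
   the strengthenings that structural congruence requires.  In a communication
   the type of one co-channel lies above the output typed on the left and its
   dual above the input typed on the right, so that the subtyping relations
   chain through the selected branch; the other shapes of redexes, which reduce
   to error, would force an impossible unfolding of this type. *)

Set Implicit Arguments.
Unset Strict Implicit.
Unset Printing Implicit Defensive.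

(** * Types and subtyping *)

(** Duality reverses subtyping: raising [T] lowers [dual T]. Subsumption therefore never acts on a
    pair of co-channels; a restriction keeps one exact [T], and slack remains only between the type
    at which a prefix is typed and the entry that it uses. The main obstacle is entries of type end.
    Subsumption may create them anywhere, and a split may send them to either side, even when they
    belong to the co-channels just bound. They can be moved, added or dropped safely because every
    entry at a non-free identifier is known to be end; covering, conversely, ensures that a name
    without an entry does not occur, which is what makes instantiation with a received channel
    injective. Since [PErr] is untypable, error rules have to be refuted; there, and in
    communication, the commutation of unrolling with duality is essential. Well-formedness of
    processes must be an invariant of congruence and reduction, as regularity is used at every
    intermediate process. *)

Section Assoc.
Variables (A B : Type).
Implicit Types (s : seq (label * A)) (l : label).

Lemma assoc_map (h : A -> B) l s :
  assoc l [seq (b.1, h b.2) | b <- s] = omap h (assoc l s).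
Proof. by elim: s => //= -[l' x] s -> /=; case: eqP. Qed.

Lemma assoc_Forall (Q : A -> Prop) l s x :
  List.Forall (fun b => Q b.2) s -> assoc l s = Some x -> Q x.
Proof.
by elim=> //= -[l' y] s' Qy _ IH /=; case: eqP => // _ [<-].
Qed.

Lemma assoc_all (p : pred A) l s x :
  all (fun b => p b.2) s -> assoc l s = Some x -> p x.
Proof.
elim: s => //= -[l' y] s IH /= /andP[py ps].
by case: eqP => [_ [<-] | _ /IH->].
Qed.

Lemma assoc_has (p : pred A) l s x :
  assoc l s = Some x -> p x -> has (fun b => p b.2) s.
Proof.
elim: s => //= -[l' y] s IH /=; case: eqP => [_ [->] -> // | _ /IH h /h ->].
by rewrite orbT.
Qed.

Lemma assoc_mem l s : l \in unzip1 s -> exists x, assoc l s = Some x.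
Proof.
elim: s => //= -[l' y] s IH; rewrite inE /=; case: eqP => [|_ /IH //].
by exists y.
Qed.

Lemma mem_assoc l s x : assoc l s = Some x -> l \in unzip1 s.
Proof.
elim: s => //= -[l' y] s IH; rewrite inE /=; case: eqP => //= _; exact: IH.
Qed.

(** [assoc] sees only the first entry with a given label; distinct labels make every element of the
    list reachable by lookup. *)
Lemma has_assoc (p : pred A) s :
  uniq (unzip1 s) -> has (fun b => p b.2) s ->
  exists l x, assoc l s = Some x /\ p x.
Proof.
elim: s => //= -[l' y] s IH /= /andP[l's /IH{}IH] /orP[py|/IH[l [x [lx px]]]].
  by exists l', y; rewrite eqxx.
exists l, x; split=> //; case: eqP => // E; case/negP: l's.
by rewrite -E (mem_assoc lx).
Qed.

Lemma all_assoc (p : pred A) s : uniq (unzip1 s) ->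
  (forall l x, assoc l s = Some x -> p x) -> all (fun b => p b.2) s.
Proof.
move=> us H; rewrite -[all _ _]negbK -has_predC; apply/negP.
by case/(@has_assoc (predC p) _ us) => l [x [/H /= ->]].
Qed.

End Assoc.

Section StypeInd.
Variable Q : stype -> Prop.
Hypotheses (QE : Q TEnd) (QV : forall n, Q (TVar n))
  (QM : forall T, Q T -> Q (TMu T))
  (QI : forall bs, List.Forall (fun b => Q b.2.1 /\ Q b.2.2) bs -> Q (TIn bs))
  (QO : forall bs, List.Forall (fun b => Q b.2.1 /\ Q b.2.2) bs -> Q (TOut bs)).

(** The generated principle gives no hypothesis for types inside branch lists; the inner fixpoint
    collects one for each exchanged type and continuation. *)
Fixpoint stype_nested_ind T : Q T :=
  let branches := fix F (bs : seq (label * (stype * stype))) :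
      List.Forall (fun b => Q b.2.1 /\ Q b.2.2) bs :=
    if bs is b :: bs' then
      List.Forall_cons b (conj (stype_nested_ind b.2.1) (stype_nested_ind b.2.2))
        (F bs')
    else List.Forall_nil _ in
  match T with
  | TEnd => QE
  | TVar n => QV n
  | TMu T => QM (stype_nested_ind T)
  | TIn bs => QI (branches bs)
  | TOut bs => QO (branches bs)
  end.
End StypeInd.

Lemma wf_type_leq j k T : j <= k -> wf_type_at j T -> wf_type_at k T.
Proof.
elim/stype_nested_ind: T j k => //=.
- by move=> n j k jk /leq_trans->.
- by move=> T IH j k jk /andP[-> /IH->].
- move=> bs IH j k jk /andP[-> /=]; elim: IH => //= b bs' [_ Hb] _ IH.
  by move=> /andP[/andP[-> /(Hb _ k jk)->] /IH->].
- move=> bs IH j k jk /andP[-> /=]; elim: IH => //= b bs' [_ Hb] _ IH.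
  by move=> /andP[/andP[-> /(Hb _ k jk)->] /IH->].
Qed.

Lemma tsubst_closed k U T : wf_type_at k T -> tsubst k U T = T.
Proof.
elim/stype_nested_ind: T k => //=.
- move=> n k nk; rewrite ltn_eqF //; case: ltnP => // kn.
  by rewrite ltnNge (ltnW kn) in nk.
- by move=> T IH k /andP[_ /IH->].
- move=> bs IH k /andP[_ wf]; congr TIn.
  elim: IH wf => //= -[l [S T]] bs' [/= HS HT] _ IH /andP[/andP[wS wT] /IH->].
  by rewrite HS ?HT // (wf_type_leq _ wS).
- move=> bs IH k /andP[_ wf]; congr TOut.
  elim: IH wf => //= -[l [S T]] bs' [/= HS HT] _ IH /andP[/andP[wS wT] /IH->].
  by rewrite HS ?HT // (wf_type_leq _ wS).
Qed.

Lemma tguard_closed j k T : j <= k -> wf_type_at j T -> tguard k T.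
Proof.
elim: T j k => //= [n j k jk nj | T IH j k jk /andP[_ wT]].
  by rewrite ltn_eqF // (leq_trans nj jk).
exact: IH wT.
Qed.

Lemma tguard_tsubst j k U T :
  wf_type U -> j < k -> tguard j T -> tguard j (tsubst k U T).
Proof.
move=> wU; elim: T j k => //= [n j k jk nj | T IH j k jk]; last exact: IH.
case: eqP => _; first exact: tguard_closed wU.
(* A variable above [k] is lowered by one and still exceeds [j], since [j < k]. *)
case: ltnP => //= kn; case: n kn {nj} => // n.
by rewrite ltnS => /(leq_trans jk) jn; rewrite gtn_eqF.
Qed.

Lemma wf_tsubst k U T :
  wf_type U -> wf_type_at k.+1 T -> wf_type_at k (tsubst k U T).
Proof.
move=> wU; elim/stype_nested_ind: T k => //=.
- move=> n k; rewrite ltnS => nk; case: eqVneq => [_|nk'].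
    exact: wf_type_leq wU.
  by rewrite ltnNge nk /= ltn_neqAle nk'.
- by move=> T IH k /andP[gT /IH->]; rewrite tguard_tsubst.
- move=> bs IH k /andP[u wf]; apply/andP; split.
    by rewrite /unzip1 -map_comp.
  rewrite all_map; elim: IH wf => //= -[l [S T]] bs' [/= HS HT] _ H.
  case/andP=> /andP[wS wT] /H->; rewrite HT // andbT andbT.
  by rewrite tsubst_closed // (wf_type_leq (leq0n k) wS).
- move=> bs IH k /andP[u wf]; apply/andP; split.
    by rewrite /unzip1 -map_comp.
  rewrite all_map; elim: IH wf => //= -[l [S T]] bs' [/= HS HT] _ H.
  case/andP=> /andP[wS wT] /H->; rewrite HT // andbT andbT.
  by rewrite tsubst_closed // (wf_type_leq (leq0n k) wS).
Qed.

Lemma wf_unfold T : wf_type (TMu T) -> wf_type (tsubst 0 (TMu T) T).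
Proof. by move=> wT; apply: wf_tsubst => //; case/andP: wT. Qed.

(* Exchanged types are not dualised but substituted into; being closed, they
   are not affected. *)
Lemma dual_tsubst k U T : wf_type_at k.+1 T ->
  dual (tsubst k U T) = tsubst k (dual U) (dual T).
Proof.
elim/stype_nested_ind: T k => //=.
- by move=> n k _; case: eqP => // _; case: ltnP.
- by move=> T IH k /andP[_ /IH->].
- move=> bs IH k /andP[_ wf]; congr TOut.
  elim: IH wf => //= -[l [S T]] bs' [/= HS HT] _ H /andP[/andP[wS wT] /H->].
  by rewrite HT // !(tsubst_closed _ (wf_type_leq (leq0n k) wS)).
- move=> bs IH k /andP[_ wf]; congr TIn.
  elim: IH wf => //= -[l [S T]] bs' [/= HS HT] _ H /andP[/andP[wS wT] /H->].
  by rewrite HT // !(tsubst_closed _ (wf_type_leq (leq0n k) wS)).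
Qed.

(** Induction along the unrolling: [dual_tsubst] turns each unrolled body into the unrolling of the
    dual, given the closed exchanged types of a well-formed [T]. *)
Lemma unfolds_dual T U : wf_type T -> unfolds T U -> unfolds (dual T) (dual U).
Proof.
move=> + TU; elim: TU => {T U} [|bs|bs|T U _ IH] wT //=; try by constructor.
constructor; rewrite -/(dual (TMu T)) -dual_tsubst; last by case/andP: wT.
exact/IH/wf_unfold.
Qed.

Lemma unfolds_wf T U : wf_type T -> unfolds T U -> wf_type U.
Proof. by move=> + TU; elim: TU => // {}T {}U _ IH /wf_unfold/IH. Qed.

Lemma unfolds_inj T U V : unfolds T U -> unfolds T V -> U = V.
Proof.
move=> TU; elim: TU V => {T U} [|bs|bs|T U _ IH] V TV; inversion TV; subst=> //.
exact: IH.
Qed.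

(** Measure for unrolling: in a contractive [TMu T] the bound variable is not at the head of [T], so
    an unrolling removes one leading mu and adds none. *)
Fixpoint leading_mus (T : stype) : nat :=
  if T is TMu T then (leading_mus T).+1 else 0.

Lemma leading_mus_tsubst k U T :
  tguard k T -> leading_mus (tsubst k U T) = leading_mus T.
Proof.
elim: T k => //= [n k /negPf-> | T IH k /IH->//].
by case: ltnP.
Qed.

Lemma unfolds_total T : wf_type T ->
  [\/ unfolds T TEnd, exists bs, unfolds T (TIn bs)
    | exists bs, unfolds T (TOut bs)].
Proof.
move: {2}(leading_mus T) (erefl (leading_mus T)) => m.
elim: m T => [|m IH] [|n|T|bs|bs] //=.
- by constructor 1; constructor.
- by constructor 2; exists bs; constructor.
- by constructor 3; exists bs; constructor.
move=> [mT] wT; have [||TE|[bs TI]|[bs TO]] := IH (tsubst 0 (TMu T) T).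
- by rewrite leading_mus_tsubst //; case/andP: wT.
- exact: wf_unfold.
- by constructor 1; constructor.
- by constructor 2; exists bs; constructor.
- by constructor 3; exists bs; constructor.
Qed.

(** Syntactic shape of the types that unroll to [TEnd]. It yields well-formedness of end-typed
    entries, which [senv_sub] admits without asking for it. *)
Fixpoint mus_end (T : stype) : bool :=
  match T with TEnd => true | TMu T => mus_end T | _ => false end.

Lemma mus_end_wf k T : mus_end T -> wf_type_at k T.
Proof.
elim: T k => //= T IH k eT; rewrite IH // andbT.
by elim: T 0 eT {IH} => //= T IH j /IH.
Qed.

Lemma unfolds_end_wf T : unfolds T TEnd -> wf_type T.
Proof.
suff H U V : unfolds U V -> V = TEnd -> mus_end U.
  by move=> /H eT; apply/mus_end_wf/eT.
elim=> {U V} // U V _ IH {}/IH.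
(* A substituted body gets this shape either by itself or because its head variable became [TMu U];
   with [T' := U] both cases conclude. *)
suff W k T' : mus_end (tsubst k (TMu U) T') -> mus_end T' \/ mus_end U.
  by case/W.
elim: T' k => [|n|T' IH|bs|bs] k //=.
- by left.
- by case: eqP => [|_]; [right | case: ifP].
- exact: IH.
Qed.

(** * Subtyping: unfolding the coinductive definition, preorder laws *)

Lemma subtypeE T T' : subtype T T' ->
  [/\ wf_type T, wf_type T' & subtype_rules subtype T T'].
Proof.
move=> [R [HR RT]]; have [wT [wT' sub]] := HR _ _ RT; split=> //.
(* Any relation closed under the rules lies below the largest one, so the premises can be restated
   with [subtype] itself. *)
have RS U U' : R U U' -> subtype U U' by exists R.
case: sub => {RT wT wT'} [U U' | U U' bs bs' TU TU' H | U U' bs bs' TU TU' H].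
- exact: sub_end.
- apply: sub_in TU TU' _ => l S' V' /H [S [V [? [/RS ? /RS ?]]]].
  by exists S, V.
- apply: sub_out TU TU' _ => l S V /H [S' [V' [? [/RS ? /RS ?]]]].
  by exists S', V'.
Qed.

Lemma subtype_end T T' : subtype T T' -> unfolds T TEnd <-> unfolds T' TEnd.
Proof.
case/subtypeE=> _ _ [] // U U' bs bs' TU TU' _.
  by split=> [/(unfolds_inj TU)|/(unfolds_inj TU')].
by split=> [/(unfolds_inj TU)|/(unfolds_inj TU')].
Qed.

Lemma subtype_inE T T' bs : subtype T T' -> unfolds T (TIn bs) ->
  exists2 bs', unfolds T' (TIn bs') & forall l S' V',
    assoc l bs' = Some (S', V') -> exists S V,
    [/\ assoc l bs = Some (S, V), subtype S S' & subtype V V'].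
Proof.
case/subtypeE=> _ _ [U U' TU _ | U U' cs cs' TU TU' H | U U' cs cs' TU _ _].
- by move/(unfolds_inj TU).
- move/(unfolds_inj TU) => [<-]; exists cs' => // l S V.
  by case/H=> [S1 [V1 [? [? ?]]]]; exists S1, V1.
- by move/(unfolds_inj TU).
Qed.

Lemma subtype_outE T T' bs : subtype T T' -> unfolds T (TOut bs) ->
  exists2 bs', unfolds T' (TOut bs') & forall l S V,
    assoc l bs = Some (S, V) -> exists S' V',
    [/\ assoc l bs' = Some (S', V'), subtype S' S & subtype V V'].
Proof.
case/subtypeE=> _ _ [U U' TU _ | U U' cs cs' TU _ _ | U U' cs cs' TU TU' H].
- by move/(unfolds_inj TU).
- by move/(unfolds_inj TU).
- move/(unfolds_inj TU) => [<-]; exists cs' => // l S V.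
  by case/H=> [S1 [V1 [? [? ?]]]]; exists S1, V1.
Qed.

Lemma wf_branches bs l S T :
  all (fun b : label * (stype * stype) =>
         wf_type_at 0 b.2.1 && wf_type_at 0 b.2.2) bs ->
  assoc l bs = Some (S, T) -> wf_type S /\ wf_type T.
Proof. by move=> wbs /(assoc_all (p := fun x => _ x.1 && _ x.2) wbs)/andP. Qed.

(** The witness is equality on well-formed types: well-formedness guarantees an unrolling and passes
    to the branches. *)
Lemma subtype_refl T : wf_type T -> subtype T T.
Proof.
move=> wT; exists (fun U U' => U = U' /\ wf_type U); split=> // {T wT} U _ [<- wU].
do 2!split=> //; case: (unfolds_total wU) => [UE|[bs UI]|[bs UO]].
- exact: sub_end.
- apply: (sub_in UI UI) => l S T lS.
  have [|wS wT] := wf_branches _ lS; first by case/andP: (unfolds_wf wU UI).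
  by exists S, T.
- apply: (sub_out UO UO) => l S T lS.
  have [|wS wT] := wf_branches _ lS; first by case/andP: (unfolds_wf wU UO).
  by exists S, T.
Qed.

(** Relational composition is closed under the rules; at outputs the contravariant exchanged types
    compose in reverse order, within the same relation. *)
Lemma subtype_trans T1 T2 T3 : subtype T1 T2 -> subtype T2 T3 -> subtype T1 T3.
Proof.
move=> T12 T23; exists (fun U V => exists2 W, subtype U W & subtype W V).
split; last by exists T2.
move=> {T1 T2 T3 T12 T23} U V [W UW WV].
have [wU _ rUW] := subtypeE UW; have [_ wV _] := subtypeE WV; do 2!split=> //.
case: rUW (UW) WV => {U W wU wV UW} [U W UE WE | U W bs bs' UI WI _ | U W bs bs' UO WO _].
- by move=> _ /subtype_end/proj1/(_ WE) VE; apply: sub_end.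
- move=> /subtype_inE/(_ UI)[cs /(unfolds_inj WI)[<-] H].
  move=> /subtype_inE/(_ WI)[cs' VI H']; apply: (sub_in UI VI) => l S T.
  case/H'=> S' [T' [/H[S0 [T0 [l0 S0S T0T]] S'S T'T]]].
  by exists S0, T0; split=> //; split; [exists S' | exists T'].
- move=> /subtype_outE/(_ UO)[cs /(unfolds_inj WO)[<-] H].
  move=> /subtype_outE/(_ WO)[cs' VO H']; apply: (sub_out UO VO) => l S T.
  case/H=> S' [T' [/H'[S0 [T0 [l0 S0S T0T]] S'S T'T]]].
  by exists S0, T0; split=> //; split; [exists S' | exists T'].
Qed.

(** * Substitution *)

Section ProcInd.
Variable Q : proc -> Prop.
Hypotheses (QN : Q PNil) (QC : forall X us, Q (PCall X us))
  (QI : forall u bs, List.Forall (fun b => Q b.2) bs -> Q (PInp u bs))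
  (QO : forall u l u' P, Q P -> Q (POut u l u' P))
  (QP : forall P P', Q P -> Q P' -> Q (PPar P P'))
  (QH : forall P P', Q P -> Q P' -> Q (PChoice P P'))
  (QD : forall n D P, Q D -> Q P -> Q (PDef n D P))
  (QU : forall P, Q P -> Q (PNu P)) (QE : Q PErr).

Fixpoint proc_nested_ind P : Q P :=
  match P with
  | PNil => QN
  | PCall X us => QC X us
  | PInp u bs =>
      QI u ((fix F (bs : seq (label * proc)) : List.Forall (fun b => Q b.2) bs :=
               if bs is b :: bs' then
                 List.Forall_cons b (proc_nested_ind b.2) (F bs')
               else List.Forall_nil _) bs)
  | POut u l u' P => QO u l u' (proc_nested_ind P)
  | PPar P P' => QP (proc_nested_ind P) (proc_nested_ind P')
  | PChoice P P' => QH (proc_nested_ind P) (proc_nested_ind P')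
  | PDef n D P => QD n (proc_nested_ind D) (proc_nested_ind P)
  | PNu P => QU (proc_nested_ind P)
  | PErr => QE
  end.
End ProcInd.

Lemma shift_var_inj n : injective (shift_var n).
Proof. by move=> [a|x] [b|y] //= [] // /addnI->. Qed.

Lemma shift_chan_inj : injective shift_chan.
Proof. by move=> [a|x] [b|y] //= [->]. Qed.

Lemma up_var_shift n f u : up_var n f (shift_var n u) = shift_var n (f u).
Proof. by case: u => //= x; rewrite ltnNge leq_addr addKn. Qed.

Lemma up_chan_shift f u : up_chan f (shift_chan u) = shift_chan (f u).
Proof. by case: u => //= a; rewrite subn2. Qed.

(** Under [n] binders an identifier is bound or a shifted outer one; on each form [up_var] reduces
    by [up_varB] or [up_var_shift], which avoids index arithmetic in case analyses. *)
Variant var_view n : ident -> Prop :=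
| VarBound x of x < n : var_view n (var x)
| VarShift u : var_view n (shift_var n u).

Lemma varP n u : var_view n u.
Proof.
case: u => [a|x]; first exact: (VarShift n (chan a)).
case: (ltnP x n) => [|nx]; first exact: VarBound.
by rewrite -(subnKC nx); exact: (VarShift n (var (x - n))).
Qed.

Variant chan_view : ident -> Prop :=
| ChanBound a of a < 2 : chan_view (chan a)
| ChanShift u : chan_view (shift_chan u).

Lemma chanP u : chan_view u.
Proof.
case: u => [[|[|a]]|x]; [exact: ChanBound | exact: ChanBound | |].
  exact: (ChanShift (chan a)).
exact: (ChanShift (var x)).
Qed.

Lemma up_varB n f x : x < n -> up_var n f (var x) = var x.
Proof. by move=> /= ->. Qed.

Lemma up_chanB f a : a < 2 -> up_chan f (chan a) = chan a.
Proof. by move=> /= ->. Qed.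

Lemma shift_var_neq n x u : x < n -> shift_var n u <> var x.
Proof. by case: u => //= y xn [E]; move: xn; rewrite -E ltnNge leq_addr. Qed.

Lemma shift_chan_neq a u : a < 2 -> shift_chan u <> chan a.
Proof. by case: u => //= b a2 [E]; move: a2; rewrite -E. Qed.

(** Lifting a composite and composing the lifted maps agree only pointwise, so the composition law
    needs this form. *)
Lemma psubst_ext P f f' g g' : f =1 f' -> g =1 g' -> psubst f g P = psubst f' g' P.
Proof.
have upv n h h' : h =1 h' -> up_var n h =1 up_var n h'.
  by move=> hh [a|x] /=; rewrite hh.
have upc h h' : h =1 h' -> up_chan h =1 up_chan h'.
  by move=> hh [a|x] /=; rewrite hh.
have upp h h' : h =1 h' -> up_pvar h =1 up_pvar h'.
  by move=> hh [|k] //=; rewrite hh.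
elim/proc_nested_ind: P f f' g g' => //=.
- by move=> X us f f' g g' ff gg; rewrite gg; congr PCall; apply: eq_map.
- move=> u bs IH f f' g g' ff gg; rewrite ff; congr PInp.
  elim: IH => //= b bs' IH _ ->; congr ((_, _) :: _).
  by apply: IH => //; apply: upv.
- by move=> u l u' P IH f f' g g' ff gg; rewrite !ff (IH _ f' _ g').
- by move=> P Q IH IH' f f' g g' ff gg; rewrite (IH _ f' _ g') // (IH' _ f' _ g').
- by move=> P Q IH IH' f f' g g' ff gg; rewrite (IH _ f' _ g') // (IH' _ f' _ g').
- move=> n D P IH IH' f f' g g' ff gg; congr PDef.
    by apply: IH; [apply: upv | apply: upp].
  by apply: IH' => //; apply: upp.
- by move=> P IH f f' g g' ff gg; congr PNu; apply: IH => //; apply: upc.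
Qed.

Lemma psubst_id P f g : f =1 id -> g =1 id -> psubst f g P = P.
Proof.
have upv n h : h =1 id -> up_var n h =1 id.
  move=> hh u; case: (varP n u) => [x /up_varB // | v].
  by rewrite up_var_shift hh.
have upc h : h =1 id -> up_chan h =1 id.
  move=> hh u; case: (chanP u) => [x /up_chanB // | v].
  by rewrite up_chan_shift hh.
have upp h : h =1 id -> up_pvar h =1 id.
  by move=> hh [|k] //=; rewrite hh.
elim/proc_nested_ind: P f g => //=.
- by move=> X us f g ff gg; rewrite gg; congr PCall; rewrite (eq_map ff) map_id.
- move=> u bs IH f g ff gg; rewrite ff; congr PInp.
  by elim: IH => //= -[l P] bs' /= IH _ ->; rewrite IH //; apply: upv.
- by move=> u l u' P IH f g ff gg; rewrite !ff IH.
- by move=> P Q IH IH' f g ff gg; rewrite IH // IH'.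
- by move=> P Q IH IH' f g ff gg; rewrite IH // IH'.
- move=> n D P IH IH' f g ff gg; congr PDef.
    by apply: IH; [apply: upv | apply: upp].
  by apply: IH' => //; apply: upp.
- by move=> P IH f g ff gg; congr PNu; apply: IH => //; apply: upc.
Qed.

Lemma psubst_comp P f f' g g' :
  psubst f' g' (psubst f g P) = psubst (f' \o f) (g' \o g) P.
Proof.
have upv n h h' : up_var n h' \o up_var n h =1 up_var n (h' \o h).
  move=> u; case: (varP n u) => [x xn | v] /=; first by rewrite !xn /= xn.
  by rewrite !up_var_shift.
have upc h h' : up_chan h' \o up_chan h =1 up_chan (h' \o h).
  move=> u; case: (chanP u) => [x xn | v] /=; first by rewrite !xn /= xn.
  by rewrite !up_chan_shift.
have upp h h' : up_pvar h' \o up_pvar h =1 up_pvar (h' \o h) by case.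
elim/proc_nested_ind: P f f' g g' => //=.
- by move=> X us f f' g g'; rewrite -map_comp.
- move=> u bs IH f f' g g'; congr PInp; rewrite -map_comp /comp /=.
  elim: IH => //= b bs' IH _ ->; rewrite IH; congr ((_, _) :: _).
  exact: psubst_ext.
- by move=> u l u' P IH f f' g g'; rewrite IH.
- by move=> P Q IH IH' f f' g g'; rewrite IH // IH'.
- by move=> P Q IH IH' f f' g g'; rewrite IH // IH'.
- by move=> n D P IH IH' f f' g g'; congr PDef; rewrite (IH, IH'); apply: psubst_ext.
- by move=> P IH f f' g g'; congr PNu; rewrite IH; apply: psubst_ext.
Qed.

(** Allows process environments to be compared only at the variables called, so that a left inverse
    of a renaming may behave arbitrarily off its image. *)
Fixpoint pfree (X : nat) (P : proc) : bool :=
  match P with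
  | PNil => false
  | PCall Y _ => X == Y
  | PInp _ bs => has (fun b => pfree X b.2) bs
  | POut _ _ _ P => pfree X P
  | PPar P Q => pfree X P || pfree X Q
  | PChoice P Q => pfree X P || pfree X Q
  | PDef _ D P => pfree X.+1 D || pfree X.+1 P
  | PNu P => pfree X P
  | PErr => false
  end.

Lemma has_Forall_ex (A I : Type) (p : pred A) (q : I -> pred A) (R : I -> Prop)
    (s : seq (label * A)) :
  List.Forall (fun b => p b.2 -> exists2 i, q i b.2 & R i) s ->
  has (fun b => p b.2) s -> exists2 i, has (fun b => q i b.2) s & R i.
Proof.
elim=> //= b s' pq _ IH /orP[/pq|/IH] [i qi Ri]; exists i; rewrite ?qi //.
by rewrite orbT.
Qed.

(** A lifted map fixes bound variables, so only shifted identifiers reach shifted ones; this brings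
    a free name of a substituted body back out of its binder. *)
Lemma up_var_img n f u v : up_var n f u = shift_var n v ->
  exists2 u', u = shift_var n u' & f u' = v.
Proof.
case: (varP n u) => [x xn | u'].
  by rewrite up_varB // => /esym/(shift_var_neq xn).
by rewrite up_var_shift => /shift_var_inj; exists u'.
Qed.

Lemma up_chan_img f u v : up_chan f u = shift_chan v ->
  exists2 u', u = shift_chan u' & f u' = v.
Proof.
case: (chanP u) => [x xn | u'].
  by rewrite up_chanB // => /esym/(shift_chan_neq xn).
by rewrite up_chan_shift => /shift_chan_inj; exists u'.
Qed.

Lemma free_psubst P f g u : free u P -> free (f u) (psubst f g P).
Proof.
elim/proc_nested_ind: P f g u => //=.
- by move=> X us f g u; apply: map_f.
- move=> u bs IH f g v /orP[/eqP->|H]; first by rewrite eqxx.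
  rewrite has_map; apply/orP; right.
  elim: IH H => //= b bs' IH _ IHbs /orP[/IH H|/IHbs->]; last by rewrite orbT.
  by rewrite -up_var_shift H.
- by move=> u l u' P IH f g v /or3P[/eqP->|/eqP->|/IH->]; rewrite ?eqxx ?orbT.
- by move=> P Q IH IH' f g u /orP[/IH->|/IH'->]; rewrite ?orbT.
- by move=> P Q IH IH' f g u /orP[/IH->|/IH'->]; rewrite ?orbT.
- move=> n D P IH IH' f g u; rewrite -up_var_shift => /orP[/IH->//|/IH'->].
  exact: orbT.
- by move=> P IH f g u /IH H; rewrite -up_chan_shift.
Qed.

Lemma psubst_free P f g v :
  free v (psubst f g P) -> exists2 u, free u P & f u = v.
Proof.
elim/proc_nested_ind: P f g v => //=.
- by move=> X us f g v /mapP[u ? ->]; exists u.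
- move=> u bs IH f g v /orP[/eqP->|]; first by exists u; rewrite ?eqxx.
  rewrite has_map => H.
  have [|w wbs <-] := @has_Forall_ex _ _
    (fun P => free (shift_var 1 v) (psubst (up_var 1 f) g P))
    (fun w P => free (shift_var 1 w) P) (fun w => f w = v) bs _ H; last by exists w; rewrite ?wbs ?orbT.
  elim: IH {H} => // b bs' IH _; constructor=> // /IH[w wP /up_var_img[w' E <-]].
  by exists w'; rewrite -?E.
- move=> u l u' P IH f g v /or3P[/eqP->|/eqP->|/IH[w wP <-]].
  + by exists u; rewrite ?eqxx.
  + by exists u'; rewrite ?eqxx ?orbT.
  + by exists w; rewrite ?wP ?orbT.
- move=> P Q IH IH' f g v /orP[/IH|/IH'][u uP <-]; exists u => //; rewrite uP //.
  exact: orbT.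
- move=> P Q IH IH' f g v /orP[/IH|/IH'][u uP <-]; exists u => //; rewrite uP //.
  exact: orbT.
- move=> n D P IH IH' f g v /orP[/IH|/IH'][u uP].
    by move=> /up_var_img[w E <-]; exists w; rewrite -?E ?uP.
  by move=> <-; exists u; rewrite ?uP ?orbT.
- by move=> P IH f g v /IH[u uP /up_chan_img[w E <-]]; exists w; rewrite -?E.
Qed.

Lemma psubst_pfree P f g X :
  pfree X (psubst f g P) -> exists2 Y, pfree Y P & g Y = X.
Proof.
elim/proc_nested_ind: P f g X => //=.
- by move=> Y us f g X /eqP->; exists Y.
- move=> u bs IH f g X; rewrite has_map => H.
  apply: (@has_Forall_ex _ _ (fun P => pfree X (psubst _ g P)) pfree _ bs _ H).
  by elim: IH {H} => // b bs' IH _; constructor=> // /IH.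
- by move=> P Q IH IH' f g v /orP[/IH|/IH'][u uP <-]; exists u => //; rewrite uP ?orbT.
- by move=> P Q IH IH' f g v /orP[/IH|/IH'][u uP <-]; exists u => //; rewrite uP ?orbT.
- move=> n D P IH IH' f g X /orP[/IH|/IH'] [[|Y] YP] //= [<-].
    by exists Y; rewrite ?YP.
  by exists Y; rewrite ?YP ?orbT.
- by move=> P IH f g X /IH.
Qed.

(** * Well-formedness under substitution, congruence and reduction *)

Lemma pguard_psubst P f g k k' : (forall X, (g X == k') = (X == k)) ->
  pguard k' (psubst f g P) = pguard k P.
Proof.
have up h j j' : (forall X, (h X == j') = (X == j)) ->
    forall X, (up_pvar h X == j'.+1) = (X == j.+1).
  by move=> hj [|X] //=; rewrite eqSS hj.
elim/proc_nested_ind: P f g k k' => //=.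
- by move=> X us f g k k' gk; rewrite gk.
- by move=> P Q IH IH' f g k k' gk; rewrite (IH _ _ k) // (IH' _ _ k).
- by move=> P Q IH IH' f g k k' gk; rewrite (IH _ _ k) // (IH' _ _ k).
- by move=> n D P IH IH' f g k k' /up gk; rewrite (IH _ _ k.+1) // (IH' _ _ k.+1).
- by move=> P IH f g k k' gk; apply: IH.
Qed.

Lemma pguard_up_pvar P f g : pguard 0 (psubst f (up_pvar g) P) = pguard 0 P.
Proof. by apply: pguard_psubst => -[]. Qed.

Lemma wf_psubst P f g : wf_proc (psubst f g P) = wf_proc P.
Proof.
elim/proc_nested_ind: P f g => //=.
- move=> u bs IH f g; rewrite size_map /unzip1 -map_comp; congr [&& _, _ & _].
  by rewrite all_map; elim: IH => //= b bs' H _ ->; rewrite H.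
- by move=> P Q IH IH' f g; rewrite IH IH'.
- by move=> P Q IH IH' f g; rewrite IH IH'.
- by move=> n D P IH IH' f g; rewrite IH IH' pguard_up_pvar.
Qed.

(** Congruence may rewrite the body of a definition, whose guardedness is part of [wf_proc]; [k] is
    arbitrary because definitions nest. *)
Lemma scong_ax_pguard k P Q : scong_ax P Q -> pguard k P = pguard k Q.
Proof.
have shiftP g f j P' : injective g -> pguard (g j) (psubst f g P') = pguard j P'.
  by move=> gI; apply: pguard_psubst => X; apply: inj_eq.
have upS : injective (up_pvar S) by move=> [|i] [|j] //= [->].
have sw : injective swap_pvar by move=> [|[|i]] [|[|j]].
case=> //= *; rewrite ?andbA ?andbT //; try by rewrite andbC.
- by rewrite (shiftP id).
- by rewrite (shiftP id).
- by rewrite (shiftP id).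
- by rewrite (shiftP succn) ?andbA //; apply: succn_inj.
- rewrite (shiftP (up_pvar S) id k.+1) //.
  rewrite (shiftP (up_pvar S) id k.+1) //.
  by rewrite (shiftP swap_pvar id k.+2) // (andbC (pguard _ _) (pguard _ _)).
Qed.

(** Only an implication: garbage collection may discard a body in which [k] is unguarded. *)
Lemma scong_pguard k P Q : scong P Q -> pguard k P -> pguard k Q.
Proof.
move=> PQ; elim: PQ k => //= {P Q}.
- by move=> P Q R _ IH _ IH' k /IH/IH'.
- by move=> P Q PQ k; rewrite (scong_ax_pguard k PQ).
- by move=> P Q PQ k; rewrite (scong_ax_pguard k PQ).
- by move=> P P' Q Q' _ IH _ IH' k /andP[/IH-> /IH'->].
- by move=> P P' Q Q' _ IH _ IH' k /andP[/IH-> /IH'->].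
- by move=> n D D' P P' _ IH _ IH' k /andP[/IH-> /IH'->].
Qed.

Lemma scong_ax_wf P Q : scong_ax P Q -> wf_proc P = wf_proc Q.
Proof.
case=> //= *; rewrite ?andbT ?wf_psubst ?andbA //; try by rewrite andbC.
- by rewrite (@pguard_psubst _ _ _ 0 0).
- by rewrite !pguard_up_pvar -!andbA; do !bool_congr.
Qed.

Lemma scong_wf P Q : scong P Q -> wf_proc P -> wf_proc Q.
Proof.
elim=> {P Q} //=.
- by move=> P Q R _ IH _ IH' /IH/IH'.
- by move=> P Q /scong_ax_wf->.
- by move=> P Q /scong_ax_wf->.
- move=> u bs1 l P P' bs2 _ IH.
  rewrite /unzip1 !map_cat !all_cat !size_cat /=.
  by case/and3P=> -> -> /and3P[-> /IH-> ->].
- by move=> P P' Q Q' _ IH _ IH' /andP[/IH-> /IH'->].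
- by move=> P P' Q Q' _ IH _ IH' /andP[/IH-> /IH'->].
- move=> n D D' P P' DD' IH _ IH' /and3P[gD /IH-> /IH'->].
  by rewrite (scong_pguard DD').
Qed.

Lemma wf_fill C P P' : (wf_proc P -> wf_proc P') ->
  wf_proc (fill C P) -> wf_proc (fill C P').
Proof.
move=> PP'; elim: C => //= [C IH Q|n D C IH]; first by case/andP=> /IH-> ->.
by case/and3P=> -> -> /IH.
Qed.

Lemma red_wf P Q : red P Q -> wf_proc P -> wf_proc Q.
Proof.
elim=> {P Q} //=.
- move=> l c P bs Q lQ /and4P[-> _ _ wbs] /=.
  by rewrite wf_psubst (assoc_all wbs lQ).
- by move=> n D cs Q _ /and3P[-> wD ->]; rewrite wf_psubst wD.
- by move=> P Q /andP[].
- by move=> C P P' _ IH; apply: wf_fill.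
- by move=> P P' Q' Q PP' _ IH QQ' /(scong_wf PP')/IH/(scong_wf QQ').
Qed.

(** * Regularity of typing *)

Implicit Types (G : penv) (E : senv).

(** The optional value serves both to retype an entry and to consume it. *)
Definition senv_set E u (o : option stype) : senv := fun v => if v == u then o else E v.

Definition covers P E := forall u, free u P -> E u <> None.
Definition senv_wf E := forall u T, E u = Some T -> wf_type T.
Definition senv_end E u := forall T, E u = Some T -> unfolds T TEnd.

Lemma senv_finite_dom E E' :
  senv_finite E -> (forall u, E u = None -> E' u = None) -> senv_finite E'.
Proof. by move=> [n nE] EE'; exists n => k /nE[/EE'-> /EE'->]. Qed.

Lemma senv_finite_set E u o : senv_finite E -> senv_finite (senv_set E u o).
Proof.
move=> [n nE]; exists (maxn n (match u with chan k => k | var k => k end).+1) => k.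
rewrite geq_max /senv_set => /andP[/nE[-> ->] uk].
by split; case: eqP => // E'; move: uk; rewrite -E' ltnn.
Qed.

Lemma senv_finite_bind_var S E : senv_finite (senv_bind_var S E) <-> senv_finite E.
Proof.
split=> -[n nE].
  by exists n => k kn; split; [case: (nE k) | case: (nE k.+1) => //; apply: leqW].
exists n.+1 => -[//|k]; rewrite ltnS => nk; split; last by case: (nE k).
by case: (nE k.+1) => //; apply: leqW.
Qed.

Lemma senv_finite_bind_chan S T E :
  senv_finite (senv_bind_chan S T E) <-> senv_finite E.
Proof.
split=> -[n nE].
  exists n => k kn; split; last by case: (nE k).
  by case: (nE k.+2) => //; do 2!apply: leqW.
exists n.+2 => -[|[|k]] //; rewrite !ltnS => nk; split; first by case: (nE k).
by case: (nE k.+2) => //; do 2!apply: leqW.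
Qed.

Lemma senv_finite_mem E (s : seq ident) :
  (forall u, u \notin s -> E u = None) -> senv_finite E.
Proof.
elim: s E => [|u s IH] E sE; first by exists 0 => k _; rewrite !sE.
(* Erase [u] so that the induction hypothesis applies, then put its entry back. *)
apply: (@senv_finite_dom (senv_set (senv_set E u None) u (E u))) => [|v].
  apply/senv_finite_set/IH => v vs; rewrite /senv_set; case: eqVneq => // vu.
  by rewrite sE // inE negb_or vu.
by rewrite /senv_set; case: (v =P u) => [->|].
Qed.

Lemma senv_seq_notin us Ts u :
  size us = size Ts -> u \notin us -> senv_seq us Ts u = None.
Proof.
by move=> sz /memNindex; rewrite /senv_seq => ->; rewrite nth_default ?size_map ?sz.
Qed.

Lemma senv_seq_mem us Ts u d : size us = size Ts -> u \in us ->
  senv_seq us Ts u = Some (nth d Ts (index u us)).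
Proof. by move=> sz uus; rewrite /senv_seq (nth_map d) // -sz index_mem. Qed.

Lemma senv_finite_seq us Ts : size us = size Ts -> senv_finite (senv_seq us Ts).
Proof. by move=> sz; apply: (@senv_finite_mem _ us) => u; apply: senv_seq_notin. Qed.

Lemma mem_params n u :
  (u \in [seq var i | i <- iota 0 n]) = if u is var x then x < n else false.
Proof.
apply/mapP/idP => [[x] | ]; first by rewrite mem_iota => + ->.
by case: u => // x xn; exists x; rewrite ?mem_iota.
Qed.

Lemma senv_bind_varE S E u : senv_bind_var S E (shift_var 1 u) = E u.
Proof. by case: u. Qed.

Lemma senv_bind_chanE S T E u : senv_bind_chan S T E (shift_chan u) = E u.
Proof. by case: u. Qed.

Lemma senv_sub_wf E E' : senv_sub E E' -> senv_wf E'.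
Proof.
move=> sub u T Eu; have := sub u; rewrite Eu.
by case: (E u) => [T' /subtypeE[]|/unfolds_end_wf].
Qed.

Lemma senv_sub_end E E' u : senv_sub E E' -> senv_end E u -> senv_end E' u.
Proof.
move=> sub endE T Eu; have := sub u; rewrite Eu.
by case Eu': (E u) => [T'|//] /subtype_end/proj1; apply; apply: endE.
Qed.

Lemma typing_regular G P E : typing G P E -> wf_proc P ->
  [/\ senv_finite E, senv_wf E, covers P E
    & forall u, ~~ free u P -> senv_end E u].
Proof.
elim=> {G P E} /=.
- move=> G P E E' _ IH sub finE' cov wP; have [_ _ _ endE] := IH wP.
  split=> //; first exact: senv_sub_wf sub.
  by move=> u /endE; apply: senv_sub_end.
- by move=> G _; split=> //; apply: (@senv_finite_mem _ [::]).
- move=> G X us Ts _ wTs sz _ _; split=> [|u T|u uus|u uus T].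
  + exact: senv_finite_seq.
  + case: (boolP (u \in us)) => [uus|/(senv_seq_notin sz)->//].
    rewrite (senv_seq_mem TEnd sz uus) => -[<-].
    by apply: (all_nthP TEnd wTs); rewrite -sz index_mem.
  + by rewrite (senv_seq_mem TEnd sz uus).
  + by rewrite (senv_seq_notin sz).
- move=> G u bs E ts Eu bsts tyP IH /and3P[bs0 ubs wbs].
  have branch l P : assoc l bs = Some P -> exists S T, assoc l ts = Some (S, T) /\
    [/\ senv_finite (senv_bind_var S (senv_add E u T)),
        senv_wf (senv_bind_var S (senv_add E u T)),
        covers P (senv_bind_var S (senv_add E u T))
      & forall v, ~~ free v P -> senv_end (senv_bind_var S (senv_add E u T)) v].
    move=> lP; have [|[S T] lST] := @assoc_mem _ l ts.
      by rewrite -bsts (mem_assoc lP).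
    exists S, T; split=> //; apply: (IH l P S T lP lST); exact: assoc_all wbs lP.
  (* One branch suffices to read off the facts about the common environment [E]; non-emptiness
     provides it. *)
  have [l [P lP]] : exists l P, assoc l bs = Some P.
    case: bs bs0 {IH tyP branch ubs wbs bsts} => // -[l P] bs _.
    by exists l, P; rewrite /= eqxx.
  have Eset T v : v != u -> senv_add E u T v = E v.
    by rewrite /senv_add => /negPf->.
  split.
  + have [S [T [_ [/senv_finite_bind_var fE _ _ _]]]] := branch l P lP.
    by apply: senv_finite_dom fE _ => v; rewrite /senv_add; case: eqP.
  (* The type of the subject is well-formed only if all its branches are, so each label of [ts] is
     matched with a branch of the process. *)
  + move=> v T; rewrite /senv_add; case: eqP => [_ [<-]|/eqP vu Ev].
      apply/andP; split; first by rewrite -bsts.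
      apply: (all_assoc (p := fun x => wf_type_at 0 x.1 && wf_type_at 0 x.2)); first by rewrite -bsts.
      move=> k [S' T'] kts; have [|Q kQ] := @assoc_mem _ k bs.
        by rewrite bsts (mem_assoc kts).
      have [S1 [T1 [kts' [_ wE _ _]]]] := branch k Q kQ.
      move: kts'; rewrite kts => -[? ?]; subst S1 T1.
      apply/andP; split; first exact: (wE (var 0)).
      by apply: (wE (shift_var 1 u)); rewrite senv_bind_varE /senv_add eqxx.
    have [S' [T' [_ [_ wE _ _]]]] := branch l P lP.
    by apply: (wE (shift_var 1 v)); rewrite senv_bind_varE Eset.
  + move=> v; rewrite /senv_add; case: eqP => //= /eqP vu; rewrite (negPf vu) /=.
    case/(has_assoc (p := free (shift_var 1 v)) ubs) => k [Q [kQ vQ]].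
    have [S' [T' [_ [_ _ cov _]]]] := branch k Q kQ.
    by have := cov _ vQ; rewrite senv_bind_varE Eset.
  + move=> v; rewrite negb_or => /andP[vu nfree] T.
    rewrite -/(senv_add E u (TIn ts) v) Eset // => Ev.
    have [S' [T' [_ [_ _ _ endE]]]] := branch l P lP.
    apply: (endE (shift_var 1 v)); last by rewrite senv_bind_varE Eset.
    by apply: contra nfree; apply: (assoc_has lP).
- move=> G u l u' P E S T Eu Eu' uu' wS _ IH /IH[finE wE cov endE].
  have Eset v : v != u -> senv_add E u T v = E v.
    by rewrite /senv_add => /negPf->.
  split.
  + apply: senv_finite_dom (senv_finite_set u' (Some S) finE) _ => v.
    by rewrite /senv_set /senv_add; case: eqP => // _; case: eqP.
  + move=> v T'; rewrite /senv_add; case: eqP => [_ [<-] //|_].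
    case: eqP => [_ [<-]|/eqP vu Ev]; last by apply: (wE v); rewrite Eset.
    have : wf_type T by apply: (wE u); rewrite /senv_add eqxx.
    by move: wS; rewrite /wf_type /= => -> ->.
  + move=> v; rewrite /senv_add; case: eqP => //= /eqP vu'; case: eqP => //= /eqP vu.
    rewrite ?(negPf vu) ?(negPf vu') /=.
    by move=> /cov; rewrite Eset.
  + move=> v; rewrite !negb_or => /and3P[vu vu' /endE].
    by rewrite /senv_end Eset // /senv_add (negPf vu) (negPf vu').
- move=> G P Q E E1 E2 split12 _ IH1 _ IH2 /andP[/IH1[f1 w1 c1 e1] /IH2[f2 w2 c2 e2]].
  split.
  + case: f1 f2 => [n nE1] [m mE2]; exists (maxn n m) => k.
    rewrite geq_max => /andP[/nE1[n1 n2] /mE2[m1 m2]].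
    have N u : E1 u = None -> E2 u = None -> E u = None.
      by case: (split12 u) => -[]; congruence.
    by split; apply: N.
  + move=> u T; case: (split12 u) => -[e1' e2'] Eu; [apply: (w1 u) | apply: (w2 u)]; congruence.
  + by move=> u /orP[/c1|/c2]; case: (split12 u) => -[e1' e2']; congruence.
  + move=> u; rewrite negb_or => /andP[u1 u2] T.
    case: (split12 u) => -[e1' e2'] Eu; [apply: (e1 u) | apply: (e2 u)] => //; congruence.
- move=> G P Q E _ IH1 _ IH2 /andP[/IH1[f1 w1 c1 e1] /IH2[f2 w2 c2 e2]].
  split=> // [u /orP[/c1|/c2] //|u].
  by rewrite negb_or => /andP[/e1].
- move=> G n D P Ts E sz _ IHD _ IH /and3P[_ wD wP].
  have [f1 w1 c1 e1] := IH wP; have [_ _ c2 _] := IHD wD.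
  split=> // [u /orP[/c2|/c1//]|u].
    (* The body is typed with parameters alone, hence by covering no outer identifier is free in
       it. *)
    have -> // : senv_seq [seq var i | i <- iota 0 n] Ts (shift_var n u) = None.
    apply: senv_seq_notin; first by rewrite size_map size_iota.
    by rewrite mem_params; case: {c2} u => //= x; rewrite ltnNge leq_addr.
  by rewrite negb_or => /andP[_ /e1].
- move=> G P T E _ IH /IH[f w c e]; split.
  + exact/senv_finite_bind_chan/f.
  + by move=> u S Eu; apply: (w (shift_chan u)); rewrite senv_bind_chanE.
  + by move=> u /c; rewrite senv_bind_chanE.
  + by move=> u /e; rewrite /senv_end senv_bind_chanE.
Qed.

(** * Inversion *)

(** The two types may differ in their leading mu's; the witness relates all types that unroll to
    end. *)
Lemma subtype_ends T T' : unfolds T TEnd -> unfolds T' TEnd -> subtype T T'.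
Proof.
move=> TE TE'; exists (fun U U' => unfolds U TEnd /\ unfolds U' TEnd).
split=> // U U' [UE UE']; split; first exact: unfolds_end_wf.
by split; [exact: unfolds_end_wf | exact: sub_end].
Qed.

(* Unlike [senv_sub], only the entries of the free identifiers of P are
   compared; the others are required to be of type end. *)
Definition senv_le P E E' :=
  [/\ senv_finite E',
      forall u T, free u P -> E u = Some T ->
        exists2 T', E' u = Some T' & subtype T T'
    & forall u, ~~ free u P -> senv_end E' u].

(** At a non-free identifier both environments hold at most an end type, and end types are
    comparable with each other and with an absent entry. *)
Lemma typing_le G P E E' :
  wf_proc P -> typing G P E -> senv_le P E E' -> typing G P E'.
Proof.
move=> wP tyP [finE' freeE' endE']; have [_ _ cov endE] := typing_regular tyP wP.
apply: (T_sub tyP) => // [u|u uP]; last first.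
  case Eu: (E u) => [T|]; last by case: (cov u uP).
  by have [T' -> _] := freeE' _ _ uP Eu.
case: (boolP (free u P)) => uP.
  case Eu: (E u) => [T|]; last by case: (cov u uP).
  by have [T' -> ] := freeE' _ _ uP Eu.
case Eu: (E u) => [T|]; case Eu': (E' u) => [T'|] //.
- by apply: subtype_ends; [apply: endE Eu | apply: endE' Eu'].
- exact: endE Eu.
- exact: endE' Eu'.
Qed.

Lemma typing_free_eq G P E E' : wf_proc P -> typing G P E -> senv_finite E' ->
  (forall u, free u P -> E' u = E u) -> (forall u, ~~ free u P -> senv_end E' u) ->
  typing G P E'.
Proof.
move=> wP tyP finE' EE' endE'; have [_ wE _ _] := typing_regular tyP wP.
apply: typing_le tyP _ => //; split=> // u T uP Eu; exists T.
  by rewrite EE'.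
exact/subtype_refl/wE/Eu.
Qed.

Lemma typing_eq G P E E' : wf_proc P -> typing G P E -> E' =1 E -> typing G P E'.
Proof.
move=> wP tyP EE'; have [fE _ _ endE] := typing_regular tyP wP.
apply: (typing_free_eq wP tyP) => // [|u uP].
  by apply: senv_finite_dom fE _ => u; rewrite EE'.
by rewrite /senv_end EE'; exact: endE.
Qed.

Lemma senv_setE E u o : senv_set E u o u = o.
Proof. by rewrite /senv_set eqxx. Qed.

Lemma senv_set_neq E u v o : v != u -> senv_set E u o v = E v.
Proof. by rewrite /senv_set => /negPf->. Qed.

(** Subsumption survives only as inequalities at the subject and object of a prefix and at the
    arguments of a call. The [PNil] clause can be trivial because [typing_regular] already says that
    all entries are end. *)
Definition typing_inv G P E : Prop :=
  match P with
  | PNil => True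
  | PCall X us => exists Ts,
      [/\ nth None G X = Some Ts, all wf_type Ts, size us = size Ts, uniq us
        & forall u T, senv_seq us Ts u = Some T ->
            exists2 T', E u = Some T' & subtype T T']
  | PInp u bs => exists T0 ts,
      [/\ E u = Some T0, subtype (TIn ts) T0, unzip1 bs = unzip1 ts
        & forall l P S T, assoc l bs = Some P -> assoc l ts = Some (S, T) ->
            typing G P (senv_bind_var S (senv_set E u (Some T)))]
  | POut u l u' P => exists T0 S0 S T,
      [/\ E u = Some T0, E u' = Some S0 & u != u'] /\
      [/\ subtype (TOut [:: (l, (S, T))]) T0, subtype S S0
        & typing G P (senv_set (senv_set E u (Some T)) u' None)]
  | PPar P Q => exists E1 E2,
      [/\ senv_split E E1 E2, typing G P E1 & typing G Q E2]
  | PChoice P Q => typing G P E /\ typing G Q E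
  | PDef n D P => exists Ts,
      [/\ size Ts = n,
          typing (Some Ts :: G) D (senv_seq (map var (iota 0 n)) Ts)
        & typing (Some Ts :: G) P E]
  | PNu P => exists T, typing G P (senv_bind_chan T (dual T) E)
  | PErr => False
  end.

Lemma senv_sub_some E E' u T : senv_sub E E' -> E' u <> None -> E u = Some T ->
  exists2 T', E' u = Some T' & subtype T T'.
Proof. by move=> /(_ u) + + Eu; rewrite Eu; case: (E' u) => // T' TT' _; exists T'. Qed.

Lemma senv_sub_set E E' u o : (forall T, o = Some T -> wf_type T) ->
  senv_sub E E' -> senv_sub (senv_set E u o) (senv_set E' u o).
Proof.
move=> wo sub v; rewrite /senv_set; case: eqP => _; last exact: sub.
by case: o wo => // T wT; apply/subtype_refl/wT.
Qed.

Lemma senv_sub_bind_var S E E' : wf_type S ->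
  senv_sub E E' -> senv_sub (senv_bind_var S E) (senv_bind_var S E').
Proof. by move=> wS sub [a|[|x]] //=; [exact: sub | exact: subtype_refl | exact: sub]. Qed.

Lemma senv_sub_bind_chan S T E E' : wf_type S -> wf_type T ->
  senv_sub E E' -> senv_sub (senv_bind_chan S T E) (senv_bind_chan S T E').
Proof.
by move=> wS wT sub [[|[|a]]|x] //=;
  [exact: subtype_refl | exact: subtype_refl | exact: sub | exact: sub].
Qed.

Lemma typing_inv_sub G P E E' : wf_proc P -> typing G P E -> typing_inv G P E ->
  senv_sub E E' -> senv_finite E' -> covers P E' -> typing_inv G P E'.
Proof.
case: P => //.
- move=> X us _ _ [Ts [GX wTs sz uus usE]] sub finE' cov.
  exists Ts; split=> // u T uT; have [T1 Eu TT1] := usE _ _ uT.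
  have [|T2 E'u T12] := senv_sub_some sub _ Eu.
    apply: cov => /=; apply: contraPT uT => /(senv_seq_notin sz).
    by move=> ->.
  by exists T2 => //; apply: subtype_trans T12.
- move=> u bs wP tyP [T0 [ts [Eu sT0 bsts branch]]] sub finE' cov.
  have [T1 E'u T01] : exists2 T1, E' u = Some T1 & subtype T0 T1.
    by apply: senv_sub_some Eu => //; apply: cov; rewrite /= eqxx.
  exists T1, ts; split=> //; first exact: subtype_trans T01.
  move=> l P S T lP lST; have wP' : wf_proc P.
    by case/and3P: wP => _ _ wbs; apply: assoc_all wbs lP.
  have tyb := branch _ _ _ _ lP lST.
  have [_ wb _ _] := typing_regular tyb wP'.
  have wS : wf_type S by apply: (wb (var 0)).
  have wT : wf_type T.
    by apply: (wb (shift_var 1 u)); rewrite senv_bind_varE senv_setE.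
  apply: (T_sub tyb).
  + by apply/senv_sub_bind_var/senv_sub_set => // _ [<-].
  + exact/senv_finite_bind_var/senv_finite_set.
  + move=> v; case: (varP 1 v) => [[|x] // _ _ // |{}v vP].
    rewrite senv_bind_varE /senv_set; case: eqP => // _.
    by apply: cov; rewrite /= (assoc_has (p := free (shift_var 1 v)) lP) ?orbT.
- move=> u l u' P wP tyP [T0 [S0 [S [T [[Eu Eu' uu'] [TT0 SS0 tyP']]]]]] sub finE' cov.
  have [T1 E'u T01] : exists2 T1, E' u = Some T1 & subtype T0 T1.
    by apply: senv_sub_some Eu => //; apply: cov; rewrite /= eqxx.
  have [S1 E'u' S01] : exists2 S1, E' u' = Some S1 & subtype S0 S1.
    by apply: senv_sub_some Eu' => //; apply: cov; rewrite /= eqxx orbT.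
  exists T1, S1, S, T; split; first by split.
  split; [exact: subtype_trans T01 | exact: subtype_trans S01 |].
  have [_ wE covP _] := typing_regular tyP' wP.
  apply: (T_sub tyP').
  + apply: senv_sub_set => //; apply: senv_sub_set => // _ [<-].
    by apply: (wE u); rewrite senv_set_neq // senv_setE.
  + exact/senv_finite_set/senv_finite_set.
  + move=> v vP; have := covP v vP; rewrite /senv_set.
    by do 2!case: eqP => // _; move=> _; apply: cov; rewrite /= vP !orbT.
- move=> P Q wPQ tyPQ [E1 [E2 [split12 tyP tyQ]]] sub finE' cov.
  case/andP: wPQ => wP wQ; have [_ _ cov1 _] := typing_regular tyP wP.
  have [_ _ cov2 _] := typing_regular tyQ wQ.
  (* Entries of [E'] follow the old split; the end-typed ones absent from [E] go to the left. *)
  exists (fun u => if E2 u is None then E' u else None).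
  exists (fun u => if E2 u is None then None else E' u); split.
  + by move=> u; case: (E2 u); [right | left].
  + apply: (T_sub tyP).
    * move=> u; have := sub u; case: (split12 u) => -[e1 e2]; rewrite ?e1 ?e2 //.
      by case: (E u).
    * by apply: senv_finite_dom finE' _ => u ->; case: (E2 u).
    * move=> u uP; have := cov1 u uP; have := cov u; rewrite /= uP => /(_ isT).
      by case: (split12 u) => -[e1 e2]; rewrite ?e1 ?e2.
  + apply: (T_sub tyQ).
    * move=> u; have := sub u; case: (split12 u) => -[e1 e2]; rewrite ?e1 ?e2 //.
      by case: (E u).
    * by apply: senv_finite_dom finE' _ => u ->; case: (E2 u).
    * move=> u uP; have := cov2 u uP; have := cov u.
      by rewrite /= uP orbT => /(_ isT); case: (E2 u).
- move=> P Q /andP[wP wQ] _ [tyP tyQ] sub finE' cov.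
  by split; [apply: (T_sub tyP) | apply: (T_sub tyQ)] => // u uP;
     apply: cov; rewrite /= uP ?orbT.
- move=> n D P _ _ [Ts [sz tyD tyP]] sub finE' cov; exists Ts; split=> //.
  by apply: (T_sub tyP) => // u uP; apply: cov; rewrite /= uP orbT.
- move=> P wP tyP [T tyP'] sub finE' cov; exists T.
  have [_ wE _ _] := typing_regular tyP' wP.
  apply: (T_sub tyP').
  + by apply: senv_sub_bind_chan => //; [apply: (wE (chan 0)) | apply: (wE (chan 1))].
  + exact/senv_finite_bind_chan.
  + move=> u; case: (chanP u) => [[|[|a]] // _ _ //|v vP].
    by rewrite senv_bind_chanE; apply: cov.
Qed.

Lemma typing_invP G P E : typing G P E -> wf_proc P -> typing_inv G P E.
Proof.
move=> tyP; elim: (tyP) => {G P E tyP}.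
- move=> G P E E' tyP IH sub finE' cov wP.
  exact: typing_inv_sub (IH wP) sub finE' cov.
- by [].
- move=> G X us Ts GX wTs sz uus _; exists Ts; split=> // u T uT.
  exists T => //; apply: subtype_refl.
  have [_ wE _ _] := typing_regular (T_call GX wTs sz uus) isT.
  exact: wE uT.
- move=> G u bs E ts Eu bsts tyb _ wP.
  have [_ wE _ _] := typing_regular (T_inp Eu bsts tyb) wP.
  exists (TIn ts), ts; rewrite /senv_add eqxx; split=> //.
    by apply/subtype_refl/(wE u); rewrite /senv_add eqxx.
  move=> l P S T lP lST; apply: typing_eq (tyb _ _ _ _ lP lST) _.
    by case/and3P: wP => _ _ wbs; apply: assoc_all wbs lP.
  by move=> [a|[|x]] //=; rewrite /senv_set /senv_add; case: eqP.
- move=> G u l u' P E S T Eu Eu' uu' wS tyP _ wP.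
  have [_ wE _ _] := typing_regular (T_out l Eu Eu' uu' wS tyP) wP.
  exists (TOut [:: (l, (S, T))]), S, S, T; rewrite /senv_add eqxx (negPf uu') eqxx.
  do 2!split=> //; try exact: subtype_refl.
    by apply/subtype_refl/(wE u); rewrite /senv_add (negPf uu') eqxx.
  apply: typing_eq tyP _ => // v; rewrite /senv_set /senv_add.
  case: (v =P u') => [->|//]; first by rewrite eq_sym (negPf uu').
  by case: eqP.
- by move=> G P Q E E1 E2 split12 tyP _ tyQ _ _; exists E1, E2.
- by move=> G P Q E tyP _ tyQ _ _.
- by move=> G n D P Ts E sz tyD _ tyP _ _; exists Ts.
- by move=> G P T E tyP _ _; exists T.
Qed.

(** [T_inp] wants a fresh subject and gives it exactly [TIn ts]; so [u] is erased, retyped, and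
    lifted to [T0] by a final subsumption. *)
Lemma typing_inp G u bs E T0 ts :
  wf_proc (PInp u bs) -> E u = Some T0 -> subtype (TIn ts) T0 ->
  unzip1 bs = unzip1 ts ->
  (forall l P S T, assoc l bs = Some P -> assoc l ts = Some (S, T) ->
     typing G P (senv_bind_var S (senv_set E u (Some T)))) ->
  typing G (PInp u bs) E.
Proof.
move=> wP Eu TT0 bsts branch.
have ty : typing G (PInp u bs) (senv_add (senv_set E u None) u (TIn ts)).
  apply: T_inp => //; first exact: senv_setE.
  move=> l P S T lP lST; apply: typing_eq (branch _ _ _ _ lP lST) _.
    by case/and3P: wP => _ _ wbs; apply: assoc_all wbs lP.
  by move=> [a|[|x]] //=; rewrite /senv_set /senv_add; case: eqP.
have [finE wE cov _] := typing_regular ty wP.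
have E0 v : v != u -> senv_add (senv_set E u None) u (TIn ts) v = E v.
  by move=> vu; rewrite /senv_add (negPf vu) senv_set_neq.
apply: (T_sub ty).
- move=> v; have [->|vu] := eqVneq v u; first by rewrite /senv_add eqxx Eu.
  by rewrite E0 //; case Ev: (E v) => [T|] //; apply/subtype_refl/(wE v); rewrite E0.
- apply: senv_finite_dom finE _ => v; have [->|vu] := eqVneq v u.
    by rewrite /senv_add eqxx.
  by rewrite E0.
- move=> v vP; have [->|vu] := eqVneq v u; first by rewrite Eu.
  by rewrite -E0 //; apply: cov.
Qed.

Lemma typing_out G u l u' P E T0 S0 S T :
  wf_proc P -> E u = Some T0 -> E u' = Some S0 -> u != u' ->
  subtype (TOut [:: (l, (S, T))]) T0 -> subtype S S0 ->
  typing G P (senv_set (senv_set E u (Some T)) u' None) ->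
  typing G (POut u l u' P) E.
Proof.
move=> wP Eu Eu' uu' TT0 SS0 tyP.
set E0 := senv_set (senv_set E u None) u' None.
have ty : typing G (POut u l u' P) (senv_add (senv_add E0 u (TOut [:: (l, (S, T))])) u' S).
  apply: T_out => //.
  - by rewrite /E0 senv_set_neq ?senv_setE.
  - exact: senv_setE.
  - by have [] := subtypeE SS0.
  - apply: typing_eq tyP _ => // v; rewrite /senv_set /senv_add /E0 /senv_set.
    by case: (v =P u) => [->|//]; rewrite (negPf uu').
have [finE wE cov _] := typing_regular ty wP.
set E1 := senv_add _ _ _ in ty finE wE cov.
have E1E v : v != u -> v != u' -> E1 v = E v.
  by move=> vu vu'; rewrite /E1 /senv_add /E0 /senv_set (negPf vu) (negPf vu').
have E1u : E1 u = Some (TOut [:: (l, (S, T))]).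
  by rewrite /E1 /senv_add (negPf uu') eqxx.
have E1u' : E1 u' = Some S by rewrite /E1 /senv_add eqxx.
apply: (T_sub ty).
- move=> v; have [->|vu] := eqVneq v u; first by rewrite E1u Eu.
  have [->|vu'] := eqVneq v u'; first by rewrite E1u' Eu'.
  by rewrite E1E //; case Ev: (E v) => [T'|] //; apply/subtype_refl/(wE v); rewrite E1E.
- apply: senv_finite_dom finE _ => v; have [->|vu] := eqVneq v u; first by rewrite E1u.
  have [->|vu'] := eqVneq v u'; first by rewrite E1u'.
  by rewrite E1E.
- move=> v vP; have [->|vu] := eqVneq v u; first by rewrite Eu.
  have [->|vu'] := eqVneq v u'; first by rewrite Eu'.
  by rewrite -E1E //; apply: cov.
Qed.

(** * Renaming *)

(** Only positions matter, so [f] merely has to keep [u] apart from the other listed identifiers. *)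
Lemma senv_seq_map f us Ts u : (forall v, v \in us -> f v = f u -> v = u) ->
  u \in us -> senv_seq (map f us) Ts (f u) = senv_seq us Ts u.
Proof.
move=> fI uus; congr nth; elim: us fI uus => //= v us IH fI.
rewrite inE; case: (v =P u) => [->|vu]; first by rewrite !eqxx.
rewrite eq_sym; case: (v =P u) => //= _ uus.
case: eqP => [/fI E|_]; first by case: vu; apply: E; rewrite inE eqxx.
by rewrite IH // => w ws; apply: fI; rewrite inE ws orbT.
Qed.

Definition penv_sub P g G G' := forall X Ts,
  pfree X P -> nth None G X = Some Ts -> nth None G' (g X) = Some Ts.

Lemma penv_sub_up n D P g G G' Ts : penv_sub (PDef n D P) g G G' ->
  penv_sub D (up_pvar g) (Some Ts :: G) (Some Ts :: G') /\
  penv_sub P (up_pvar g) (Some Ts :: G) (Some Ts :: G').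
Proof.
move=> sub; split=> -[|X] Ts' //= XP; apply: sub; rewrite /= XP ?orbT //.
Qed.

(* Injectivity is only available on the free identifiers: E may have entries
   of type end for other identifiers which f identifies with free ones. *)
Definition senv_ren P f E E' :=
  [/\ senv_finite E',
      forall u v, free u P -> free v P -> f u = f v -> u = v,
      forall u, free u P -> E' (f u) = E u
    & forall v T, E' v = Some T ->
        unfolds T TEnd \/ exists2 u, E u = Some T & f u = v].

(** Induction on the process, made possible by inversion. End-typed entries of [E'] without origin
    in [E] travel down to the leaves, where subsumption absorbs them. *)
Lemma typing_psubst P G G' E E' f g :
  wf_proc P -> typing G P E -> penv_sub P g G G' -> senv_ren P f E E' ->
  typing G' (psubst f g P) E'.
Proof.
elim/proc_nested_ind: P G G' E E' f g.
- move=> G G' E E' f g wP tyP _ [finE' _ _ endE'] /=.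
  have [_ _ _ endE] := typing_regular tyP wP.
  apply: (T_sub (T_nil _)) => // v; rewrite /senv_empty.
  case E'v: (E' v) => [T|] //; case: (endE' _ _ E'v) => // -[u Eu _].
  exact: endE Eu.
- move=> X us G G' E E' f g wP tyP GG' [finE' fI fE endE'] /=.
  have [_ _ cov endE] := typing_regular tyP wP.
  have [Ts [GX wTs sz uus sub]] := typing_invP tyP wP.
  have sz' : size (map f us) = size Ts by rewrite size_map.
  apply: (T_sub (T_call (us := map f us) (Ts := Ts) _ _ _ _)) => //.
  + by apply: GG' => //=.
  + by rewrite map_inj_in_uniq.
  + move=> v; case: (boolP (v \in map f us)) => [/mapP[u uus' ->]|vus].
      rewrite senv_seq_map // => [|w wus fwu]; last exact: fI.
      have := sub u; rewrite (senv_seq_mem TEnd sz uus') fE // => /(_ _ erefl).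
      by case=> T' ->.
    rewrite (senv_seq_notin sz' vus); case E'v: (E' v) => [T|] //.
    case: (endE' _ _ E'v) => // -[u Eu fu]; apply: (endE u) => //=.
    by apply: contra vus => uus'; rewrite -fu map_f.
  + move=> v /mapP[u uus' ->]; rewrite fE //; exact: cov.
- move=> u bs IH G G' E E' f g wP tyP GG' [finE' fI fE endE'] /=.
  have [T0 [ts [Eu sT0 bsts branch]]] := typing_invP tyP wP.
  have free_u : free u (PInp u bs) by rewrite /= eqxx.
  apply: (@typing_inp _ _ _ _ T0 ts) => //.
  + by rewrite -(wf_psubst (PInp u bs) f g) in wP.
  + by rewrite fE.
  + by rewrite -bsts /unzip1 -map_comp.
  move=> l P' S T; rewrite (assoc_map (psubst _ _)).
  case lP: (assoc l bs) => [P|] //= [<-] lST.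
  have inP v : free (shift_var 1 v) P -> free v (PInp u bs).
    by move=> vP; rewrite /= (assoc_has (p := free (shift_var 1 v)) lP) ?orbT.
  have IHP := assoc_Forall (Q := fun P => forall G G' E E' f g, wf_proc P ->
    typing G P E -> penv_sub P g G G' -> senv_ren P f E E' ->
    typing G' (psubst f g P) E') IH lP.
  apply: IHP (branch _ _ _ _ lP lST) _ _.
  + by case/and3P: wP => _ _ wbs; apply: assoc_all wbs lP.
  + by move=> X Ts XP; apply: GG' => /=; apply: (assoc_has (p := pfree X) lP).
  split.
  + exact/senv_finite_bind_var/senv_finite_set.
  + move=> v w; case: (varP 1 v) => [x x1|{}v]; case: (varP 1 w) => [y y1|{}w].
    * by rewrite !up_varB.
    * by rewrite up_varB // up_var_shift => _ _ /esym/(shift_var_neq x1).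
    * by rewrite (up_varB _ y1) // up_var_shift => _ _ /(shift_var_neq y1).
    * by move=> /inP vP /inP wP'; rewrite !up_var_shift => /shift_var_inj/fI->.
  + move=> v; case: (varP 1 v) => [[|//]//|{}v /inP vP].
    rewrite up_var_shift !senv_bind_varE /senv_set.
    case: (v =P u) => [->|vu]; first by rewrite eqxx.
    by case: eqP => [/fI|_]; [move/(_ vP free_u) | rewrite fE].
  + move=> v T'; case: (varP 1 v) => [[|//] _ /= [<-]|{}v].
      by right; exists (var 0).
    rewrite senv_bind_varE /senv_set; case: eqP => [-> [<-]|vu].
      by right; exists (shift_var 1 u); rewrite ?senv_bind_varE ?eqxx ?up_var_shift.
    case/endE' => [|[w Ew fw]]; first by left.
    right; exists (shift_var 1 w); rewrite ?senv_bind_varE ?up_var_shift ?fw //.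
    by case: eqP => // wu; case: vu; rewrite -fw wu.
- move=> u l u' P IH G G' E E' f g wP tyP GG' [finE' fI fE endE'] /=.
  have [T0 [S0 [S [T [[Eu Eu' uu'] [TT0 SS0 tyP']]]]]] := typing_invP tyP wP.
  have [_ _ cov _] := typing_regular tyP' wP.
  have free_u : free u (POut u l u' P) by rewrite /= eqxx.
  have free_u' : free u' (POut u l u' P) by rewrite /= eqxx orbT.
  have inP v : free v P -> free v (POut u l u' P) by move=> /= ->; rewrite !orbT.
  apply: (@typing_out _ _ _ _ _ _ T0 S0 S T) => //.
  + by rewrite wf_psubst.
  + by rewrite fE.
  + by rewrite fE.
  + by apply: contra_neq uu' => /fI; apply.
  apply: IH tyP' _ _ => //; split.
  + exact/senv_finite_set/senv_finite_set.
  + by move=> v w /inP vP /inP; apply: fI.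
  + move=> v vP; have := cov v vP; rewrite /senv_set.
    case: (v =P u') => // vu' _; case: eqP => [/fI|_].
      by move/(_ (inP _ vP) free_u').
    case: (v =P u) => [->|vu]; first by rewrite eqxx.
    by case: eqP => [/fI|_]; [move/(_ (inP _ vP) free_u) | rewrite fE ?inP].
  + move=> v T'; rewrite /senv_set; case: eqP => // vu'.
    case: eqP => [-> [<-]|vu].
      by right; exists u; rewrite ?eqxx ?(negPf uu').
    case/endE' => [|[w Ew fw]]; first by left.
    right; exists w => //; case: eqP => [wu'|_]; first by case: vu'; rewrite -fw wu'.
    by case: eqP => // wu; case: vu; rewrite -fw wu.
- move=> P Q IHP IHQ G G' E E' f g /[dup] wPQ /andP[wP wQ] tyPQ GG'.
  move=> [finE' fI fE endE'] /=.
  have [E1 [E2 [split12 tyP tyQ]]] := typing_invP tyPQ wPQ.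
  have [_ _ cov1 end1] := typing_regular tyP wP.
  have [_ _ cov2 _] := typing_regular tyQ wQ.
  have inP v : free v P -> free v (PPar P Q) by move=> /= ->.
  have inQ v : free v Q -> free v (PPar P Q) by move=> /= ->; rewrite orbT.
  (* The split of [E] cannot be transported along [f], which may identify a stray entry with a free
     identifier. Freeness in the renamed left component decides instead; all other entries go
     right. *)
  apply: (@T_par _ _ _ _ (fun v => if free v (psubst f g P) then E' v else None)
    (fun v => if free v (psubst f g P) then None else E' v)).
  + by move=> v; case: ifP; [left | right].
  + apply: IHP tyP _ _ => //; first by move=> X Ts XP; apply: GG'; rewrite /= XP.
    split.
    * by apply: senv_finite_dom finE' _ => v ->; case: ifP.
    * by move=> v w /inP vP /inP; apply: fI.
    * move=> v vP; rewrite free_psubst // fE ?inP //.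
      by have := cov1 v vP; case: (split12 v) => -[e1 _]; rewrite e1.
    * move=> v T; case: ifP => // /psubst_free[u uP <-]; rewrite fE ?inP // => Eu.
      right; exists u => //; have := cov1 u uP.
      by case: (split12 u) => -[e1 _]; rewrite e1.
  + apply: IHQ tyQ _ _ => //; first by move=> X Ts XP; apply: GG'; rewrite /= XP orbT.
    split.
    * by apply: senv_finite_dom finE' _ => v ->; case: ifP.
    * by move=> v w /inQ vP /inQ; apply: fI.
    * move=> v vQ; have E1v : E1 v = None.
        by have := cov2 v vQ; case: (split12 v) => -[e1 e2]; rewrite e1 ?e2.
      (* A name free on both sides after renaming would come, by injectivity, from one free in both
         [P] and [Q], against the disjoint split. *)
      case: ifP => [/psubst_free[u uP fuv]|_].
        by case: (cov1 u uP); rewrite (fI u v (inP _ uP) (inQ _ vQ) fuv).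
      have := cov2 v vQ; rewrite fE ?inQ //.
      by case: (split12 v) => -[_ ->].
    * move=> v T; case: ifP => // vP /endE'[|[u Eu fu]]; first by left.
      case: (split12 u) => -[e1 e2]; last by right; exists u; rewrite ?e2.
      (* The origin [u] belonged to the left but is not free in [P], so its type is end. *)
      left; apply: (end1 u); last by rewrite e1.
      by apply: contraFN vP => /(free_psubst f g); rewrite fu.
- move=> P Q IHP IHQ G G' E E' f g /[dup] wPQ /andP[wP wQ] tyPQ GG'.
  move=> [finE' fI fE endE'] /=.
  have [tyP tyQ] := typing_invP tyPQ wPQ.
  have inP v : free v P -> free v (PChoice P Q) by move=> /= ->.
  have inQ v : free v Q -> free v (PChoice P Q) by move=> /= ->; rewrite orbT.
  apply: T_choice.
  + apply: IHP tyP _ _ => //; first by move=> X Ts XP; apply: GG'; rewrite /= XP.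
    by split=> // [u v /inP uP /inP|u /inP]; [apply: fI | apply: fE].
  + apply: IHQ tyQ _ _ => //; first by move=> X Ts XP; apply: GG'; rewrite /= XP orbT.
    by split=> // [u v /inQ uP /inQ|u /inQ]; [apply: fI | apply: fE].
- move=> n D P IHD IHP G G' E E' f g /[dup] wDP /and3P[_ wD wP] tyDP GG'.
  move=> [finE' fI fE endE'] /=.
  have [Ts [sz tyD tyP]] := typing_invP tyDP wDP.
  have [GD GP] := penv_sub_up Ts GG'.
  have sz' : size [seq var i | i <- iota 0 n] = size Ts.
    by rewrite size_map size_iota.
  have [finD _ covD _] := typing_regular tyD wD.
  (* The lifted map fixes parameters, the only free identifiers of the body, so the body keeps its
     environment whatever [f] is. *)
  have up_param u : u \in [seq var i | i <- iota 0 n] -> up_var n f u = u.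
    by rewrite mem_params; case: u => // x; apply: up_varB.
  have param u : senv_seq [seq var i | i <- iota 0 n] Ts u <> None ->
      u \in [seq var i | i <- iota 0 n].
    by case: (boolP (u \in _)) => // /(senv_seq_notin sz') ->.
  have inP v : free v P -> free v (PDef n D P) by move=> /= ->; rewrite orbT.
  apply: (T_def sz).
  + apply: IHD tyD _ _ => //; split=> //.
    * by move=> u v /covD/param/up_param-> /covD/param/up_param->.
    * by move=> u /covD/param/up_param->.
    * by move=> v T Ev; right; exists v => //; apply/up_param/param; rewrite Ev.
  + apply: IHP tyP _ _ => //.
    by split=> // [u v /inP uP /inP|u /inP]; [apply: fI | apply: fE].
- move=> P IH G G' E E' f g wP tyP GG' [finE' fI fE endE'] /=.
  have [T tyP'] := typing_invP tyP wP.
  apply: (@T_nu _ _ T); apply: IH tyP' _ _ => //; split.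
  + exact/senv_finite_bind_chan.
  + move=> v w; case: (chanP v) => [a a2|{}v]; case: (chanP w) => [b b2|{}w].
    * by rewrite !up_chanB.
    * by rewrite up_chanB // up_chan_shift => _ _ /esym/(shift_chan_neq a2).
    * by rewrite (up_chanB _ b2) // up_chan_shift => _ _ /(shift_chan_neq b2).
    * by move=> vP wP'; rewrite !up_chan_shift => /shift_chan_inj/fI->.
  + move=> v; case: (chanP v) => [a a2 _|{}v vP].
      by rewrite up_chanB //; case: a a2 => [|[]].
    by rewrite up_chan_shift !senv_bind_chanE fE.
  + move=> v T'; case: (chanP v) => [a a2 Ev|{}v].
      right; exists (chan a); last exact: up_chanB.
      by case: a a2 Ev => [|[]].
    rewrite senv_bind_chanE => /endE'[|[w Ew fw]]; first by left.
    by right; exists (shift_chan w); rewrite ?senv_bind_chanE ?up_chan_shift ?fw.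
- by move=> G G' E E' f g wP tyP; have := typing_invP tyP wP.
Qed.

(** * Structural congruence *)

Lemma typing_psubst_inj P G G' E E' f g :
  wf_proc P -> typing G P E -> penv_sub P g G G' ->
  injective f -> senv_finite E' -> (forall u, E' (f u) = E u) ->
  (forall v T, E' v = Some T -> exists u, f u = v) ->
  typing G' (psubst f g P) E'.
Proof.
move=> wP tyP GG' fI finE' fE codom; apply: typing_psubst tyP GG' _ => //.
split=> // [u v _ _|v T E'v]; first exact: fI.
by have [u fu] := codom _ _ E'v; right; exists u; rewrite -?fE ?fu.
Qed.

(** [f'] need not be injective, but it is on the image of [f], where all free identifiers of the
    renamed process lie; so renaming back falls under [typing_psubst]. *)
Lemma typing_psubst_can P G G' E f f' g g' :
  wf_proc P -> cancel f f' -> cancel g g' -> typing G (psubst f g P) E ->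
  (forall X Ts, nth None G (g X) = Some Ts -> nth None G' X = Some Ts) ->
  senv_finite (E \o f) -> typing G' P (E \o f).
Proof.
move=> wP ff gg tyP GG' finE.
have <- : psubst f' g' (psubst f g P) = P by rewrite psubst_comp psubst_id.
apply: typing_psubst tyP _ _; first by rewrite wf_psubst.
  by move=> X Ts /psubst_pfree[Y _ <-] /GG'; rewrite gg.
split=> // [u v /psubst_free[u1 _ <-] /psubst_free[v1 _ <-]|u|v T /= Ev].
- by rewrite !ff => ->.
- by move=> /psubst_free[u1 _ <-] /=; rewrite ff.
- by right; exists (f v); rewrite ?ff.
Qed.

(** * Shifts and exchanges of channels and process variables *)

Definition senv_lift E : senv := fun u =>
  match u with
  | chan a.+2 => E (chan a)
  | chan _ => None
  | var x => E (var x)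
  end.

Lemma senv_liftE E u : senv_lift E (shift_chan u) = E u.
Proof. by case: u. Qed.

Lemma senv_finite_lift E : senv_finite E -> senv_finite (senv_lift E).
Proof.
(* [TEnd] is a filler: finiteness concerns the domain only. *)
move=> /(senv_finite_bind_chan TEnd TEnd) finE; apply: senv_finite_dom finE _.
by move=> [[|[|a]]|x].
Qed.

Lemma senv_finite_unlift E : senv_finite E -> senv_finite (E \o shift_chan).
Proof.
move=> finE; apply/(senv_finite_bind_chan TEnd TEnd).
apply: (@senv_finite_dom (senv_set (senv_set E (chan 0) (Some TEnd)) (chan 1) (Some TEnd))).
  exact/senv_finite_set/senv_finite_set.
by move=> [[|[|a]]|x].
Qed.

(** Truncated subtraction also sends channels 0 and 1 to 0; this is harmless since they are outside
    the image of [shift_chan]. *)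
Definition unshift_chan (u : ident) : ident :=
  if u is chan a then chan (a - 2) else u.

Lemma shift_chanK : cancel shift_chan unshift_chan.
Proof. by case=> //= a; rewrite subn2. Qed.

Lemma typing_weaken_chan G P E :
  wf_proc P -> typing G P E -> typing G (psubst shift_chan id P) (senv_lift E).
Proof.
move=> wP tyP; have [finE _ _ _] := typing_regular tyP wP.
apply: typing_psubst_inj tyP _ _ _ _ _ => //.
- exact: shift_chan_inj.
- exact: senv_finite_lift.
- exact: senv_liftE.
- by move=> v T; case: (chanP v) => [[|[]] //|u _]; exists u.
Qed.

Lemma typing_strengthen_chan G P E : wf_proc P ->
  typing G (psubst shift_chan id P) E -> typing G P (E \o shift_chan).
Proof.
move=> wP tyP; apply: (typing_psubst_can wP shift_chanK (g' := id) _ tyP) => //.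
by apply: senv_finite_unlift; have [] := typing_regular tyP; rewrite ?wf_psubst.
Qed.

(** [G'] may hold further positions off the image of [g]. One equivalence serves scope extension of
    a definition and, with an involutive [g], the exchange of two. *)
Lemma typing_pvar G G' P E g g' : wf_proc P -> cancel g g' ->
  (forall X, nth None G' (g X) = nth None G X) ->
  typing G' (psubst id g P) E <-> typing G P E.
Proof.
move=> wP gg' GG'; split=> tyP.
  apply: (typing_psubst_can (f := id) (f' := id) wP _ gg' tyP) => //.
    by move=> X Ts; rewrite GG'.
  by have [] := typing_regular tyP; rewrite ?wf_psubst.
have [finE _ _ _] := typing_regular tyP wP.
apply: typing_psubst_inj tyP _ _ _ _ _ => //.
- by move=> X Ts _; rewrite GG'.
- by move=> v T _; exists v.
Qed.

Lemma typing_swap_nu G P T T' E : wf_proc P ->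
  typing G P (senv_bind_chan T (dual T) (senv_bind_chan T' (dual T') E)) ->
  typing G (psubst swap_nu id P)
    (senv_bind_chan T' (dual T') (senv_bind_chan T (dual T) E)).
Proof.
move=> wP tyP; have [finE _ _ _] := typing_regular tyP wP.
have swapK : involutive swap_nu by case=> [[|[|[|[|a]]]]|x].
apply: typing_psubst_inj tyP _ _ _ _ _ => //.
- exact: inv_inj.
- by do 2!apply/senv_finite_bind_chan; move/senv_finite_bind_chan/senv_finite_bind_chan: finE.
- by case=> [[|[|[|[|a]]]]|x].
- by move=> v S _; exists (swap_nu v).
Qed.

(** By covering, the free identifiers of a body are parameters, and [f] fixes these; applied to the
    shift of a body under a restriction and to its left inverse. *)
Lemma typing_def_body G G' n D f Ts : size Ts = n -> wf_proc D ->
  (forall x, f (var x) = var x) ->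
  typing G D (senv_seq (map var (iota 0 n)) Ts) ->
  penv_sub D id G G' ->
  typing G' (psubst f id D) (senv_seq (map var (iota 0 n)) Ts).
Proof.
move=> sz wD fvar tyD GG'; have [finD _ covD _] := typing_regular tyD wD.
have sz' : size [seq var i | i <- iota 0 n] = size Ts.
  by rewrite size_map size_iota.
have fid u : senv_seq [seq var i | i <- iota 0 n] Ts u <> None -> f u = u.
  case: (boolP (u \in [seq var i | i <- iota 0 n])) => [|/(senv_seq_notin sz')-> //].
  by rewrite mem_params; case: u.
apply: typing_psubst tyD GG' _ => //; split=> //.
- by move=> u v /covD/fid-> /covD/fid->.
- by move=> u /covD/fid->.
- by move=> v T Ev; right; exists v => //; apply: fid; rewrite Ev.
Qed.

Lemma senv_split_sym E E1 E2 : senv_split E E1 E2 -> senv_split E E2 E1.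
Proof. by move=> split12 u; case: (split12 u) => -[]; [right | left]. Qed.

Lemma typing_nil G E :
  senv_finite E -> (forall u, senv_end E u) -> typing G PNil E.
Proof.
move=> finE endE; apply: (T_sub (T_nil _)) => // u; rewrite /senv_empty.
by case Eu: (E u) => [T|] //; apply: endE Eu.
Qed.

Lemma typing_nu_par G P Q E : wf_proc P -> wf_proc Q ->
  typing G (PPar (PNu P) Q) E <->
  typing G (PNu (PPar P (psubst shift_chan id Q))) E.
Proof.
move=> wP wQ; have wQ' : wf_proc (psubst shift_chan id Q) by rewrite wf_psubst.
split=> tyPQ.
  have [E1 [E2 [split12 tyP tyQ]]] := typing_invP tyPQ (introT andP (conj wP wQ)).
  have [T {}tyP] := typing_invP tyP wP.
  apply: (@T_nu _ _ T); apply: T_par tyP (typing_weaken_chan wQ tyQ).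
  by case=> [[|[|a]]|x] /=; [left | left | exact: split12 | exact: split12].
have [T {}tyPQ] := typing_invP tyPQ (introT andP (conj wP wQ')).
have [E1 [E2 [split12 tyP tyQ]]] := typing_invP tyPQ (introT andP (conj wP wQ')).
have [finE1 _ cov1 end1] := typing_regular tyP wP.
have [_ _ cov2 end2] := typing_regular tyQ wQ'.
apply: (T_par (E1 := E1 \o shift_chan) (E2 := E2 \o shift_chan)).
- by move=> u; have := split12 (shift_chan u); rewrite senv_bind_chanE.
- have nonfree a : a < 2 -> ~~ free (chan a) (psubst shift_chan id Q).
    by move=> a2; apply/negP => /psubst_free[u _ /(shift_chan_neq a2)].
  (* The split may give the right side a co-channel that the shifted [Q] cannot mention. Its type is
     then end, so it can be restored on the left as an entry at a non-free identifier. *)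
  have bindE u : E1 u = senv_bind_chan T (dual T) (E1 \o shift_chan) u \/
      E1 u = None /\ senv_end (senv_bind_chan T (dual T) (E1 \o shift_chan)) u.
    case: u => [[|[|a]]|x]; [ | | by left | by left].
      case: (split12 (chan 0)) => -[e1 e2]; [by left | right].
      by split=> // S ES; apply: (end2 (chan 0)); rewrite ?nonfree ?e2.
    case: (split12 (chan 1)) => -[e1 e2]; [by left | right].
    by split=> // S ES; apply: (end2 (chan 1)); rewrite ?nonfree ?e2.
  apply: (@T_nu _ _ T); apply: typing_free_eq tyP _ _ _ => //.
  + exact/senv_finite_bind_chan/senv_finite_unlift.
  + by move=> u uP; case: (bindE u) => [->//|[/(cov1 u uP)]].
  + move=> u uP; case: (bindE u) => [e|[]//].
    by rewrite /senv_end -e; apply: end1.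
- exact: typing_strengthen_chan tyQ.
Qed.

Lemma scong_ax_typing G P Q E : scong_ax P Q -> wf_proc P ->
  typing G P E <-> typing G Q E.
Proof.
case.
- move=> {}P /= wP; split=> tyP.
    have [finE _ _ _] := typing_regular tyP wP.
    have [E1 [E2 [split12 tyN {}tyP]]] := typing_invP tyP wP.
    (* [PNil] may own entries, but only of type end; these can be added to the environment of
       [P]. *)
    have [_ _ _ end1] := typing_regular tyN isT.
    have [_ _ cov2 end2] := typing_regular tyP wP.
    apply: typing_free_eq tyP _ _ _ => // u uP.
      by have := cov2 u uP; case: (split12 u) => -[_ ->].
    move=> T Eu; case: (split12 u) => -[e1 e2].
      by apply: (end1 u) => //; rewrite e1.
    by apply: (end2 u) => //; rewrite e2.
  by apply: T_par (T_nil G) tyP => u; right.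
- have comm P1 P2 : wf_proc (PPar P1 P2) -> typing G (PPar P1 P2) E ->
      typing G (PPar P2 P1) E.
    move=> w12 /typing_invP/(_ w12)[E1 [E2 [/senv_split_sym split12 ty1 ty2]]].
    exact: T_par split12 ty2 ty1.
  by move=> {}P {}Q wPQ; split; apply: comm => //; rewrite /= andbC.
- move=> {}P {}Q R /= wPQR; case/andP: (wPQR) => /andP[wP wQ] wR; split=> tyPQR.
    have [E12 [E3 [sp tyPQ tyR]]] := typing_invP tyPQR wPQR.
    have [E1 [E2 [sp' tyP tyQ]]] := typing_invP tyPQ (introT andP (conj wP wQ)).
    apply: (T_par (E1 := E1) (E2 := fun u => if E2 u is Some T then Some T else E3 u)) => //.
      move=> u; case: (sp u) => -[e1 e2]; case: (sp' u) => -[e3 e4].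
      + by left; rewrite e3 e4 e1 e2.
      + by right; rewrite e3 e4 e1 e2; case: (E u).
      + by right; rewrite e3 e4 e1 e2.
      + by right; rewrite e3 e4 e1 e2.
    apply: T_par tyQ tyR => u; case: (sp u) => -[e1 e2]; case: (sp' u) => -[e3 e4].
    + by right; rewrite e4.
    + by left; rewrite e4 e1 e2; case: (E u).
    + by right; rewrite e4.
    + by right; rewrite e4 e1.
  have wQR : wf_proc (PPar Q R) by rewrite /= wQ.
  have wPQR' : wf_proc (PPar P (PPar Q R)) by rewrite /= wP wQ.
  have [E1 [E23 [sp tyP tyQR]]] := typing_invP tyPQR wPQR'.
  have [E2 [E3 [sp' tyQ tyR]]] := typing_invP tyQR wQR.
  apply: (T_par (E1 := fun u => if E1 u is Some T then Some T else E2 u) (E2 := E3)) => //.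
    move=> u; case: (sp u) => -[e1 e2]; case: (sp' u) => -[e3 e4].
    + by left; rewrite e4 e1 e3 e2; case: (E u).
    + by left; rewrite e4 e1 e3 e2; case: (E u).
    + by left; rewrite e4 e1 e3 e2.
    + by right; rewrite e3 e4 e1 e2.
  apply: T_par tyP tyQ => u; case: (sp u) => -[e1 e2]; case: (sp' u) => -[e3 e4].
  + by left; rewrite e1 e3 e2; case: (E u).
  + by left; rewrite e1 e3; case: (E u).
  + by right; rewrite e1.
  + by right; rewrite e1.
- have comm P1 P2 : wf_proc (PChoice P1 P2) -> typing G (PChoice P1 P2) E ->
      typing G (PChoice P2 P1) E.
    by move=> w12 /typing_invP/(_ w12)[ty1 ty2]; apply: T_choice.
  by move=> {}P {}Q wPQ; split; apply: comm => //; rewrite /= andbC.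
- move=> {}P {}Q R wPQR; have /and3P[wP wQ wR] : [&& wf_proc P, wf_proc Q & wf_proc R].
    by rewrite andbA.
  split=> tyPQR.
    have [tyPQ tyR] := typing_invP tyPQR wPQR.
    have [tyP tyQ] := typing_invP tyPQ (introT andP (conj wP wQ)).
    by do 2?apply: T_choice.
  have wPQR' : wf_proc (PChoice P (PChoice Q R)) by apply/and3P.
  have [tyP tyQR] := typing_invP tyPQR wPQR'.
  have [tyQ tyR] := typing_invP tyQR (introT andP (conj wQ wR)).
  by do 2?apply: T_choice.
- move=> _; split=> tyN; have [finE _ _ endE] := typing_regular tyN isT.
    by apply: typing_nil => // u; apply: endE.
  (* [TEnd] is self-dual, so the extended environment stays entirely of type end. *)
  apply: (@T_nu _ _ TEnd); apply: typing_nil.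
    exact/senv_finite_bind_chan.
  by move=> [[|[|a]]|x] T /=; [case=> <-; constructor | case=> <-; constructor
    | exact: (endE (chan a) isT) | exact: (endE (var x) isT)].
- by move=> {}P {}Q /= /andP[]; apply: typing_nu_par.
- have swap P1 : wf_proc P1 -> typing G (PNu (PNu P1)) E ->
      typing G (PNu (PNu (psubst swap_nu id P1))) E.
    move=> w1 /typing_invP/(_ w1)[T /typing_invP/(_ w1)[T' ty1]].
    by apply: (@T_nu _ _ T'); apply: (@T_nu _ _ T); apply: typing_swap_nu.
  move=> {}P /= wP; split; first exact: swap.
  (* The converse is the same implication for the swapped process, the swap being an involution. *)
  move/swap; rewrite wf_psubst psubst_comp psubst_id //; first exact.
  by case=> [[|[|[|[|a]]]]|x].
- move=> n D {}P wDP; case/and3P: (wDP) => gD wD wP; split=> tyP.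
    have [Ts [sz tyD {}tyP]] := typing_invP tyP wDP.
    have [T {}tyP] := typing_invP tyP wP.
    by apply: (@T_nu _ _ T); apply: (T_def sz _ tyP); apply: typing_def_body tyD _.
  have wDP' : wf_proc (PDef n (psubst shift_chan id D) P).
    by apply/and3P; split; rewrite -/wf_proc ?wf_psubst ?(@pguard_psubst _ _ _ 0 0).
  have [T {}tyP] := typing_invP tyP wDP'.
  have [Ts [sz tyD {}tyP]] := typing_invP tyP wDP'.
  apply: (T_def sz _ (T_nu tyP)).
  have -> : D = psubst unshift_chan id (psubst shift_chan id D).
    by rewrite psubst_comp psubst_id //; apply: shift_chanK.
  by apply: typing_def_body tyD _ => //; rewrite wf_psubst.
- move=> n D {}P {}Q wDPQ; case/andP: (wDPQ) => wDP wQ; case/and3P: (wDP) => gD wD wP.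
  split=> tyPQ.
    have [E1 [E2 [sp tyP tyQ]]] := typing_invP tyPQ wDPQ.
    have [Ts [sz tyD {}tyP]] := typing_invP tyP wDP.
    apply: (T_def sz tyD); apply: (T_par sp tyP).
    exact/(@typing_pvar G (Some Ts :: G) Q E2 succn predn wQ (fun=> erefl) (fun=> erefl)).
  have wDPQ' : wf_proc (PDef n D (PPar P (psubst id S Q))).
    by apply/and3P; split=> //; apply/andP; rewrite -/wf_proc wf_psubst.
  have [Ts [sz tyD {}tyPQ]] := typing_invP tyPQ wDPQ'.
  have [|E1 [E2 [sp tyP tyQ]]] := typing_invP tyPQ _; first by apply/andP; rewrite -/wf_proc wf_psubst.
  apply: (T_par sp (T_def sz tyD tyP)).
  exact/(@typing_pvar G (Some Ts :: G) Q E2 succn predn wQ (fun=> erefl) (fun=> erefl)).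
- have upSK : cancel (up_pvar S) (up_pvar predn) by case.
  have swap n D m D' P1 : wf_proc (PDef n D (PDef m (psubst id (up_pvar S) D') P1)) ->
      typing G (PDef n D (PDef m (psubst id (up_pvar S) D') P1)) E ->
      typing G (PDef m D' (PDef n (psubst id (up_pvar S) D) (psubst id swap_pvar P1))) E.
    move=> w tyP; case/and3P: (w) => gD wD w'; case/and3P: (w') => gD' wD' w1.
    have {}wD' : wf_proc D' by rewrite -(wf_psubst D' id (up_pvar S)).
    have [Ts [sz tyD {}tyP]] := typing_invP tyP w.
    have [Ts' [sz' tyD' {}tyP]] := typing_invP tyP w'.
    have upS T1 T2 X : nth None [:: T1, T2 & G] (up_pvar S X) = nth None (T1 :: G) X.
      by case: X.
    apply: (T_def sz'); first exact/(typing_pvar _ wD' upSK (upS _ (Some Ts))).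
    apply: (T_def sz); first exact/(typing_pvar _ wD upSK (upS _ (Some Ts'))).
    have swapK : cancel swap_pvar swap_pvar by case=> [|[]].
    by apply/(@typing_pvar [:: Some Ts', Some Ts & G] _ _ _ _ _ w1 swapK) => // -[|[]].
  move=> n D m D' {}P w; split; first exact: swap.
  (* Exchanging twice restores the process, so the converse is another instance of [swap]. *)
  have swapE : psubst id swap_pvar (psubst id swap_pvar P) = P.
    by rewrite psubst_comp psubst_id //; case=> [|[]].
  move/swap; rewrite swapE.
  by apply; move: w; rewrite (scong_ax_wf (sc_def_def _ _ _ _ _)).
Qed.

(** * Reduction *)

Lemma assoc_cat (A : Type) l (s1 s2 : seq (label * A)) :
  assoc l (s1 ++ s2) = if assoc l s1 is Some x then Some x else assoc l s2.
Proof. by elim: s1 => //= -[l' x] s1 ->; case: eqP. Qed.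

(** An implication only: garbage collection forgets that the body of the definition was typable. *)
Lemma scong_typing G P Q E : scong P Q -> wf_proc P -> typing G P E -> typing G Q E.
Proof.
move=> PQ; elim: PQ G E => {P Q} //.
- move=> P Q R PQ IH _ IH' G E wP tyP.
  exact: IH' (scong_wf PQ wP) (IH _ _ wP tyP).
- by move=> P Q PQ G E wP /(scong_ax_typing _ _ PQ wP).
- move=> P Q PQ G E wQ tyQ; apply/(scong_ax_typing _ _ PQ) => //.
  by rewrite (scong_ax_wf PQ).
- move=> n D G E wD tyD; have [Ts [_ _ tyN]] := typing_invP tyD wD.
  have [finE _ _ endE] := typing_regular tyN isT.
  by apply: typing_nil => // u; apply: endE.
- move=> u bs1 l P P' bs2 PP' IH G E wP tyP.
  have [T0 [ts [Eu sT0 bsts branch]]] := typing_invP tyP wP.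
  apply: (typing_inp (scong_wf (sc_inp u bs1 l bs2 PP') wP) Eu sT0).
    by rewrite -bsts /unzip1 !map_cat.
  move=> k R S T kR kST.
  have := fun R' kR' => branch k R' S T kR' kST; move: kR.
  rewrite !assoc_cat /=; case: (assoc k bs1) => [R'|].
    by move=> [<-] /(_ _ erefl).
  case: eqP => _ kR; last by move/(_ _ kR).
  case: kR => <- /(_ _ erefl); apply: IH.
  case/and3P: wP => _ _; rewrite all_cat /=.
  by case/and3P.
- move=> u l u' P P' PP' IH G E wP tyP.
  have [T0 [S0 [S [T [[Eu Eu' uu'] [TT0 SS0 tyP']]]]]] := typing_invP tyP wP.
  by apply: (typing_out (scong_wf PP' wP) Eu Eu' uu' TT0 SS0); apply: IH.
- move=> P P' Q Q' _ IHP _ IHQ G E wPQ tyPQ; case/andP: (wPQ) => wP wQ.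
  have [E1 [E2 [sp tyP tyQ]]] := typing_invP tyPQ wPQ.
  exact: T_par sp (IHP _ _ wP tyP) (IHQ _ _ wQ tyQ).
- move=> P P' Q Q' _ IHP _ IHQ G E wPQ tyPQ; case/andP: (wPQ) => wP wQ.
  have [tyP tyQ] := typing_invP tyPQ wPQ.
  exact: T_choice (IHP _ _ wP tyP) (IHQ _ _ wQ tyQ).
- move=> n D D' P P' _ IHD _ IHP G E wDP tyDP; case/and3P: (wDP) => _ wD wP.
  have [Ts [sz tyD tyP]] := typing_invP tyDP wDP.
  exact: T_def sz (IHD _ _ wD tyD) (IHP _ _ wP tyP).
- move=> P P' _ IH G E wP tyP; have [T {}tyP] := typing_invP tyP wP.
  exact: T_nu (IH _ _ wP tyP).
Qed.

(** Linearity enters here: [c] has no entry in [E], so by covering [Q] does not mention it, and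
    putting [c] for variable 0 is injective on free identifiers. *)
Lemma typing_inst1 G Q S E c : wf_proc Q -> typing G Q (senv_bind_var S E) ->
  E (chan c) = None -> typing G (inst [:: c] Q) (senv_set E (chan c) (Some S)).
Proof.
move=> wQ tyQ Ec; have [finE _ cov _] := typing_regular tyQ wQ.
rewrite /inst; set f := fun u : ident => _.
have f0 : f (var 0) = chan c by [].
have fS v : f (shift_var 1 v) = v by case: v => //= x; rewrite subn1.
have neq_c v : free (shift_var 1 v) Q -> v <> chan c.
  by move=> /cov; rewrite senv_bind_varE => + E'; rewrite E'.
apply: typing_psubst tyQ _ _ => //; split.
- exact/senv_finite_set/senv_finite_bind_var/finE.
- move=> u v; case: (varP 1 u) => [[|//] _|{}u]; case: (varP 1 v) => [[|//] _|{}v] //.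
  + by rewrite f0 fS => _ /neq_c + E'; rewrite -E'.
  + by rewrite f0 fS => /neq_c.
  + by rewrite !fS => _ _ ->.
- move=> u; case: (varP 1 u) => [[|//] _|{}u /neq_c uc].
    by rewrite f0 senv_setE.
  by rewrite fS senv_bind_varE senv_set_neq //; apply/eqP.
- move=> v T; rewrite /senv_set; case: eqP => [-> [<-]|_ Ev].
    by right; exists (var 0).
  by right; exists (shift_var 1 v); rewrite ?fS ?senv_bind_varE.
Qed.

(** Distinct arguments keep the instantiation injective on the parameters, the only free identifiers
    of the body. *)
Lemma typing_inst_params G D cs Ts : wf_proc D -> size cs = size Ts -> uniq cs ->
  typing G D (senv_seq (map var (iota 0 (size cs))) Ts) ->
  typing G (inst cs D) (senv_seq (map chan cs) Ts).
Proof.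
move=> wD sz ucs tyD; have [_ _ cov _] := typing_regular tyD wD.
rewrite /inst; set f := fun u : ident => _.
set ps := [seq var i | i <- iota 0 (size cs)] in tyD cov *.
have szp : size ps = size Ts by rewrite size_map size_iota.
have fps : map chan cs = map f ps.
  rewrite -{1}(mkseq_nth 0 cs) /mkseq /ps -!map_comp; apply/eq_in_map => i.
  by rewrite mem_iota /= => ->.
have fI : {in ps &, injective f}.
  move=> [a|x] [b|y]; rewrite !mem_params // => xs ys; rewrite /f xs ys => -[].
  by move/eqP; rewrite nth_uniq // => /eqP->.
have in_ps u : free u D -> u \in ps.
  by move/cov; case: (boolP (u \in ps)) => // /(senv_seq_notin szp)->.
apply: typing_psubst tyD _ _ => //; split.
- by apply: senv_finite_seq; rewrite size_map.
- by move=> u v /in_ps ups /in_ps vps; apply: fI.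
- move=> u /in_ps ups; rewrite fps senv_seq_map // => v vps; exact: fI.
- move=> v T; rewrite fps; case: (boolP (v \in map f ps)).
    case/mapP => u ups ->; rewrite senv_seq_map //.
      by move=> Eu; right; exists u.
    by move=> w wps; apply: fI.
  by move/senv_seq_notin => -> //; rewrite size_map.
Qed.

(** * Preservation by each reduction rule *)

Lemma subtype_in_not_end ts T : subtype (TIn ts) T -> ~ unfolds T TEnd.
Proof. by move=> /subtype_end/proj2 H /H{}H; inversion H. Qed.

Lemma subtype_out_not_end ts T : subtype (TOut ts) T -> ~ unfolds T TEnd.
Proof. by move=> /subtype_end/proj2 H /H{}H; inversion H. Qed.

Lemma senv_split_l E E1 E2 u T : senv_split E E1 E2 -> E1 u = Some T ->
  E u = Some T /\ E2 u = None.
Proof. by move=> /(_ u)[] [-> ?]. Qed.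

Lemma senv_split_r E E1 E2 u T : senv_split E E1 E2 -> E2 u = Some T ->
  E u = Some T /\ E1 u = None.
Proof. by move=> /(_ u)[] [? ->]. Qed.

(** Subtyping keeps a prefix type away from end, and prefixes on other subjects leave the entry of
    [a] unchanged. This is the fact that refutes the orphan rule. *)
Lemma subject_typing G P E a : wf_proc P -> typing G P E -> subject a P ->
  exists2 T, E (chan a) = Some T & ~ unfolds T TEnd.
Proof.
elim/proc_nested_ind: P G E a => //.
- move=> u bs IH G E a wP tyP /=.
  have [T0 [ts [Eu sT0 bsts branch]]] := typing_invP tyP wP.
  case: (chan a =P u) => [-> _|/eqP au].
    by exists T0 => //; apply: subtype_in_not_end sT0.
  case/and3P: wP => _ ubs wbs.
  rewrite ?(negPf au) => /(has_assoc (p := subject a) ubs)[l [P [lP aP]]].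
  have [|[S T] lST] := @assoc_mem _ l ts; first by rewrite -bsts (mem_assoc lP).
  have IHP := assoc_Forall (Q := fun P => forall G E a, wf_proc P ->
    typing G P E -> subject a P ->
    exists2 T, E (chan a) = Some T & ~ unfolds T TEnd) IH lP.
  have [|T' /=] := IHP _ _ _ _ (branch _ _ _ _ lP lST) aP.
    exact: assoc_all wbs lP.
  by rewrite senv_set_neq // => Ea nT'; exists T'.
- move=> u l u' P IH G E a wP tyP /=.
  have [T0 [S0 [S [T [[Eu Eu' uu'] [TT0 SS0 tyP']]]]]] := typing_invP tyP wP.
  case: (chan a =P u) => [-> _|/eqP au].
    by exists T0 => //; apply: subtype_out_not_end TT0.
  rewrite ?(negPf au) => /(IH _ _ _ wP tyP')[T'].
  (* [a] is not the object either, since the object has no entry in the continuation. *)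
  rewrite /senv_set; case: eqP => // _; rewrite (negPf au) => Ea nT'.
  by exists T'.
- move=> P Q IHP IHQ G E a wPQ tyPQ; case/andP: (wPQ) => wP wQ.
  have [E1 [E2 [sp tyP tyQ]]] := typing_invP tyPQ wPQ.
  case/orP=> [/(IHP _ _ _ wP tyP)|/(IHQ _ _ _ wQ tyQ)][T Ea nT]; exists T => //.
    by case: (senv_split_l sp Ea).
  by case: (senv_split_r sp Ea).
- move=> P Q IHP IHQ G E a wPQ tyPQ; case/andP: (wPQ) => wP wQ.
  have [tyP tyQ] := typing_invP tyPQ wPQ.
  by case/orP=> [/(IHP _ _ _ wP tyP)|/(IHQ _ _ _ wQ tyQ)].
- move=> n D P _ IH G E a wDP tyDP aP; case/and3P: (wDP) => _ wD wP.
  have [Ts [_ _ tyP]] := typing_invP tyDP wDP; exact: IH wP tyP aP.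
- move=> P IH G E a wP tyP aP; have [T {}tyP] := typing_invP tyP wP.
  exact: IH wP tyP aP.
Qed.

Lemma typing_nu_par_inv G P Q E : typing G (PNu (PPar P Q)) E -> wf_proc (PPar P Q) ->
  exists T E1 E2, [/\ wf_type T, senv_split (senv_bind_chan T (dual T) E) E1 E2,
    typing G P E1 & typing G Q E2].
Proof.
move=> tyPQ wPQ; have [T {}tyPQ] := typing_invP tyPQ wPQ.
have [E1 [E2 [sp tyP tyQ]]] := typing_invP tyPQ wPQ.
have [_ wE _ _] := typing_regular tyPQ wPQ.
by exists T, E1, E2; split=> //; apply: (wE (chan 0)).
Qed.

(** The output label is among the selections of [T], hence offered by [dual T], hence by the input.
    As a matching branch always exists, this settles both communication and the label error. *)
Lemma typing_com G l c P bs E :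
  wf_proc (PPar (POut (chan 0) l (chan c) P) (PInp (chan 1) bs)) ->
  typing G (PNu (PPar (POut (chan 0) l (chan c) P) (PInp (chan 1) bs))) E ->
  exists2 Q, assoc l bs = Some Q & typing G (PNu (PPar P (inst [:: c] Q))) E.
Proof.
move=> w ty; case/andP: (w) => wO wI.
have [T [E1 [E2 [wT sp tyO tyI]]]] := typing_nu_par_inv ty w.
have [T0 [Sc [S [T1 [[E10 E1c c0] [T1T0 SSc tyP]]]]]] := typing_invP tyO wO.
have [T0' [ts [E21 tsT0' bsts branch]]] := typing_invP tyI wI.
have [[TT0] E20] := senv_split_l sp E10; have [[TT0'] E11] := senv_split_r sp E21.
have [Ec E2c] := senv_split_l sp E1c; subst T0 T0'.
have [os TO] := subtype_outE T1T0 (unfolds_out _).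
rewrite /= => /(_ l S T1); rewrite eqxx => /(_ erefl)[S' [T' [lST' S'S T1T']]].
have [is_ TI branches] := subtype_inE tsT0' (unfolds_in _).
have lis : assoc l is_ = Some (S', dual T').
  have := unfolds_inj TI (unfolds_dual wT TO) => -[->].
  by rewrite (assoc_map (fun x => (x.1, dual x.2))) lST'.
have [S2 [T2 [lts S2S' T2T']]] := branches _ _ _ lis.
have [|Q lQ] := @assoc_mem _ l bs; first by rewrite bsts (mem_assoc lts).
have wQ : wf_proc Q by case/and3P: wI => _ _ wbs; apply: assoc_all wbs lQ.
have c1 : chan c != chan 1 by apply/eqP => c1; rewrite c1 E11 in E1c.
have tyQ := branch _ _ _ _ lQ lts.
have {tyQ} tyQ : typing G (inst [:: c] Q)
    (senv_set (senv_set E2 (chan 1) (Some T2)) (chan c) (Some S2)).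
  by apply: typing_inst1 => //; rewrite senv_set_neq.
(* The restriction continues with [T'], the continuation inside [T] itself: [T1] lies below [T'] and
   [T2] below [dual T']. *)
exists Q => //; apply: (@T_nu _ _ T').
have wP : wf_proc P := wO.
have [finP wEP covP _] := typing_regular tyP wP.
have wQc : wf_proc (inst [:: c] Q) by rewrite wf_psubst.
have [finQ wEQ covQ _] := typing_regular tyQ wQc.
(* Ownership of [c] passes from left to right at its old type [Sc], which the receiver's [S2]
   reaches through [S'] and [S]. *)
apply: (@T_par _ _ _ _ (senv_set (senv_set E1 (chan 0) (Some T')) (chan c) None)
  (senv_set (senv_set E2 (chan 1) (Some (dual T'))) (chan c) (Some Sc))).
- move=> u; rewrite /senv_set; case: eqP => [->|_].
    by right; split=> //; rewrite -Ec; case: (c) c0 c1 => [|[|c']].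
  case: eqP => [->|/eqP u0]; first by left.
  case: eqP => [->|/eqP u1]; first by right.
  by have := sp u; case: u u0 u1 => [[|[|a]]|x].
- apply: (T_sub tyP).
  + move=> u; have := wEP u; rewrite /senv_set; case: eqP => // _.
    case: eqP => // _; case: (E1 u) => // S3 w3; exact/subtype_refl/w3.
  + apply: senv_finite_dom finP _ => u; rewrite /senv_set.
    by do 2?case: eqP.
  + by move=> u /covP; rewrite /senv_set; do 2?case: eqP.
- apply: (T_sub tyQ).
  + move=> u; have := wEQ u; rewrite /senv_set; case: eqP => [_ _|_].
      exact: subtype_trans S2S' (subtype_trans S'S SSc).
    by case: eqP => // _; case: (E2 u) => // S3 w3; exact/subtype_refl/w3.
  + apply: senv_finite_dom finQ _ => u; rewrite /senv_set.
    by do 2?case: eqP.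
  + by move=> u /covQ; rewrite /senv_set; do 2?case: eqP.
Qed.

Lemma fill_typing C P P' :
  (forall G E, wf_proc P -> typing G P E -> typing G P' E) ->
  forall G E, wf_proc (fill C P) -> typing G (fill C P) E -> typing G (fill C P') E.
Proof.
move=> PP'; elim: C => //= [C IH Q|C IH|n D C IH] G E w ty.
- have [E1 [E2 [sp tyC tyQ]]] := typing_invP ty w; case/andP: w => wC wQ.
  exact: T_par sp (IH _ _ wC tyC) tyQ.
- have [T tyC] := typing_invP ty w; exact: T_nu (IH _ _ w tyC).
- have [Ts [sz tyD tyC]] := typing_invP ty w; case/and3P: w => _ _ wC.
  exact: T_def sz tyD (IH _ _ wC tyC).
Qed.

Lemma fill_err_typing C G E : wf_proc (fill C PErr) -> ~ typing G (fill C PErr) E.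
Proof.
elim: C G E => //= [|C IH Q|C IH|n D C IH] G E w ty.
- exact: typing_invP ty w.
- have [E1 [E2 [_ tyC _]]] := typing_invP ty w; case/andP: w => wC _.
  exact: IH wC tyC.
- have [T tyC] := typing_invP ty w; exact: IH w tyC.
- have [Ts [_ _ tyC]] := typing_invP ty w; case/and3P: w => _ _ wC.
  exact: IH wC tyC.
Qed.

Lemma red_typing G P Q E : red P Q -> wf_proc P -> typing G P E -> typing G Q E.
Proof.
move=> PQ; elim: PQ G E => {P Q}.
- move=> l c P bs Q lQ G E w ty; have [Q'] := typing_com w ty.
  by rewrite lQ => -[<-].
- move=> n D cs Q sz G E w ty; case/and3P: (w) => _ wD wP.
  have [Ts [szTs tyD {}ty]] := typing_invP ty w.
  have [E1 [E2 [sp tyC tyQ]]] := typing_invP ty wP.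
  (* Position 0 holds [Ts], so the call is typed with the very parameter types of the body. *)
  have [Ts' [[<-] wTs szc ucs sub]] := typing_invP tyC isT.
  have [finE1 _ _ endE1] := typing_regular tyC isT.
  rewrite size_map in szc.
  have tyI : typing (Some Ts :: G) (inst cs D) (senv_seq (map chan cs) Ts).
    apply: typing_inst_params => //; last by rewrite sz.
    by apply: map_uniq ucs.
  have wI : wf_proc (inst cs D) by rewrite wf_psubst.
  have [_ _ covI _] := typing_regular tyI wI.
  apply: (T_def szTs tyD); apply: (T_par sp _ tyQ); apply: (T_sub tyI) => //.
  + move=> u; have := sub u; case Su: (senv_seq _ _ u) => [T|].
      by move=> /(_ _ erefl)[T' ->].
    move=> _; case Eu: (E1 u) => [T|] //; apply: (endE1 u) => //=.
    apply/negP => ucs'; move: Su; rewrite (senv_seq_mem TEnd) ?size_map //.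
  + move=> u /covI; have := sub u; case: (senv_seq _ _ u) => // T.
    by case/(_ _ erefl) => T' ->.
- by move=> P Q G E w ty; have [] := typing_invP ty w.
- by move=> C P P' _ IH; apply: fill_typing.
- move=> P P' Q' Q PP' red IH QQ' G E w ty.
  have w' := scong_wf PP' w; apply: (scong_typing QQ'); first exact: red_wf red w'.
  by apply: IH => //; apply: scong_typing PP' w ty.
- move=> l c P bs lbs G E w ty; have [Q] := typing_com w ty.
  by rewrite lbs.
- move=> P sP nfP G E w ty; have [T {}ty] := typing_invP ty w.
  have [_ wE _ endE] := typing_regular ty w.
  have [_ [<-] nT] := subject_typing (P := P) w ty sP.
  (* Co-channel 1 is not free, so [dual T] is end, whereas the subject keeps [T] away from end; no
     unrolling of [T] allows both. *)
  have dT : unfolds (dual T) TEnd by apply: (endE (chan 1)).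
  have [//|[bs TI]|[bs TO]] := unfolds_total (wE (chan 0) T erefl).
  + by have := unfolds_inj dT (unfolds_dual (wE (chan 0) T erefl) TI).
  + by have := unfolds_inj dT (unfolds_dual (wE (chan 0) T erefl) TO).
- move=> l c P l' c' Q G E w ty; case/andP: (w) => wP wQ.
  have [T [E1 [E2 [wT sp tyP tyQ]]]] := typing_nu_par_inv ty w.
  have [T0 [_ [S0 [T1 [[E10 _ _] [TT0 _ _]]]]]] := typing_invP tyP wP.
  have [T0' [_ [S0' [T1' [[E21 _ _] [TT0' _ _]]]]]] := typing_invP tyQ wQ.
  have [[?] _] := senv_split_l sp E10; have [[?] _] := senv_split_r sp E21.
  subst T0 T0'; have [os TO _] := subtype_outE TT0 (unfolds_out _).
  have [os' TO' _] := subtype_outE TT0' (unfolds_out _).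
  (* [T] and [dual T] would both unroll to output types, but the dual of an output type is an input
     type. *)
  by have := unfolds_inj TO' (unfolds_dual wT TO).
- move=> bs bs' G E w ty; case/andP: (w) => wP wQ.
  have [T [E1 [E2 [wT sp tyP tyQ]]]] := typing_nu_par_inv ty w.
  have [T0 [ts [E10 TT0 _ _]]] := typing_invP tyP wP.
  have [T0' [ts' [E21 TT0' _ _]]] := typing_invP tyQ wQ.
  have [[?] _] := senv_split_l sp E10; have [[?] _] := senv_split_r sp E21.
  subst T0 T0'; have [os TO _] := subtype_inE TT0 (unfolds_in _).
  have [os' TO' _] := subtype_inE TT0' (unfolds_in _).
  by have := unfolds_inj TO' (unfolds_dual wT TO).
- by move=> C G E w /(fill_err_typing w).
Qed.

Theorem theorem2p2 (Gamma : penv) (P Q : proc) (Delta : senv)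
    (hwf : wf_proc P) (htyp : typing Gamma P Delta) (hred : reds P Q) :
  typing Gamma Q Delta.
Proof.
(* Well-formedness joins the invariant because [red_typing] requires it of every intermediate
   process. *)
suff [//] : typing Gamma Q Delta /\ wf_proc Q.
elim: hred hwf htyp => {P Q} [P Q PQ|P|P Q R _ IHP _ IHQ] wP tyP //.
  by split; [apply: red_typing PQ wP tyP | apply: red_wf PQ wP].
by have [tyQ wQ] := IHP wP tyP; apply: IHQ.
Qed.
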